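(* Let $G$ be any locally finite, connected graph that is transient for simple random walk. For every cluster observable $F:\mathcal X\to\mathbb C$ of (at most) polynomial growth and every $X\in\mathcal X$, the function $\overline F^X(h)=\mathbb E\big[F(\mathcal C_X(h))\mathbf 1_{\{|\mathcal C_X(h)|<\infty\}}\big]$ is well-defined and $C^\infty$ on $\mathbb R\setminus[\widetilde h,\hat h]$.
   Context: Setting as follows. For $G=(V,E)$, $g(x,y)=\frac{1}{d(y)}\sum_{n\ge0}P_x[X_n=y]$ is the Green function of simple random walk ($d(y)$ the degree); the GFF $\varphi$ is the centered Gaussian field with covariance $g$; clusters are connected components of the induced subgraph $\{\varphi\ge h\}$; $\mathcal C_o(h)$ is the cluster of a fixed vertex $o$ and $h_*=\sup\{h:\mathbb P[|\mathcal C_o(h)|=\infty]>0\}$. $\mathcal X$ is the family of finite subsets of $V$; $\mathcal C_X(h)$ is the union of clusters intersecting $X\in\mathcal X$. $\overline S=S\cup\{x\notin S: x\sim y\text{ for some }y\in S\}$; $\mathrm{cap}(K)=\sum_{x\in K}d(x)P_x[\widetilde H_K=\infty]$ with $\widetilde H_K=\min\{n\ge1:X_n\in K\}$. $A^X_N(h)=\{|\mathcal C_X(h)|<\infty\}\cap\{N-1\le\mathrm{cap}(\overline{\mathcal C_X(h)})<N\}$. $F$ has (at most) polynomial growth if there is $C<\infty$ with $|F(S)|\le C(1+\mathrm{cap}(\overline S))^C$ for all $S\in\mathcal X$. A sequence $(c_N)_{N\ge1}$ of nonnegative numbers decays super-polynomially fast if $\log(c_N)/\log N\to-\infty$. Define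 $\widetilde h=\sup\{h<h_*:\ \forall X\in\mathcal X\ \exists(c_N)\text{ decaying super-polynomially fast with }\mathbb P[A^X_N(h')]\le c_N\ \forall N\ge1,\ \forall h'\le h\}$ and $\hat h=\inf\{h>h_*:\ \forall X\in\mathcal X\ \exists(c_N)\text{ decaying super-polynomially fast with }\mathbb P[A^X_N(h')]\le c_N\ \forall N\ge1,\ \forall h'\ge h\}$ (with $\sup\emptyset=-\infty$, $\inf\emptyset=+\infty$). *)

(* Defs.v *)
From HB Require Import structures.
From mathcomp Require Import all_boot all_order all_algebra.
From mathcomp Require Import all_classical all_reals all_analysis.
Set Implicit Arguments.
Unset Strict Implicit.
Unset Printing Implicit Defensive.
Import Order.TTheory GRing.Theory Num.Theory.
Import numFieldNormedType.Exports.
Local Open Scope classical_set_scope.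
Local Open Scope ring_scope.

Definition adj (V : countType) (nb : V -> seq V) : rel V := fun x y => y \in nb x.

Definition simple_graph (V : countType) (nb : V -> seq V) : Prop :=
  forall x, uniq (nb x) /\ x \notin nb x /\ (forall y, y \in nb x -> x \in nb y).

Definition graph_connected (V : countType) (nb : V -> seq V) : Prop :=
  forall x y : V, exists p : seq V, path (adj nb) x p /\ last x p = y.

Definition deg {R : realType} (V : countType) (nb : V -> seq V) (x : V) : R :=
  (size (nb x))%:R.

(* srw n x y = P_x[X_n = y] for simple random walk *)
Fixpoint srw {R : realType} (V : countType) (nb : V -> seq V) (n : nat) (x y : V) : R :=
  match n with
  | 0 => (x == y)%:R
  | n'.+1 => (deg nb x)^-1 * \sum_(z <- nb x) srw nb n' z y
  end.

(* transience (simple random walk well-defined, i.e. no isolated vertex, and)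
   the expected number of visits to x starting from x is finite *)
Definition transient {R : realType} (V : countType) (nb : V -> seq V) : Prop :=
  forall x : V, (0 < size (nb x))%N /\ cvg (series (fun n => @srw R V nb n x x) @ \oo).

Definition green {R : realType} (V : countType) (nb : V -> seq V) (x y : V) : R :=
  (deg nb y)^-1 * limn (series (fun n => @srw R V nb n x y)).

(* avoid K n y = P_y[X_k \notin K for 0 <= k < n] *)
Fixpoint avoid {R : realType} (V : countType) (nb : V -> seq V) (K : set V)
    (n : nat) (y : V) : R :=
  match n with
  | 0 => 1
  | n'.+1 => (y \notin K)%:R * ((deg nb y)^-1 * \sum_(z <- nb y) avoid nb K n' z)
  end.

(* escN K N x = P_x[X_n \notin K for 1 <= n <= N] *)
Definition escN {R : realType} (V : countType) (nb : V -> seq V) (K : set V)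
    (N : nat) (x : V) : R :=
  (deg nb x)^-1 * \sum_(z <- nb x) @avoid R V nb K N z.

(* P_x[\tilde H_K = oo] = lim_N escN K N x (a decreasing limit) *)
Definition esc {R : realType} (V : countType) (nb : V -> seq V) (K : set V) (x : V) : R :=
  limn (fun N => @escN R V nb K N x).

Definition cap {R : realType} (V : countType) (nb : V -> seq V) (K : set V) : R :=
  \sum_(x \in K) (deg nb x * @esc R V nb K x).

Definition closure_nb (V : countType) (nb : V -> seq V) (S : set V) : set V :=
  S `|` [set x | exists y, S y /\ adj nb y x].

Definition centered_normal_law {R : realType} d (Omega : measurableType d)
    (P : probability Omega R) (Y : Omega -> R) (v : R) : Prop :=
  forall A : set R, measurable A ->
    P (Y @^-1` A) = (if v == 0 then \d_(0:R) A else normal_prob 0 (Num.sqrt v) A).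

Definition is_GFF {R : realType} (V : countType) (nb : V -> seq V) d
    (Omega : measurableType d) (P : probability Omega R) (phi : V -> Omega -> R) : Prop :=
  (forall x, measurable_fun setT (phi x)) /\
  forall (s : seq V) (a : V -> R),
    centered_normal_law P (fun w => \sum_(x <- s) a x * phi x w)
      (\sum_(x <- s) \sum_(y <- s) a x * a y * green nb x y).

Definition cluster {R : realType} (V : countType) (nb : V -> seq V) (Omega : Type)
    (phi : V -> Omega -> R) (h : R) (X : set V) (w : Omega) : set V :=
  [set y | exists x (p : seq V), X x /\ path (adj nb) x p /\ last x p = y /\
           all (fun v => h <= phi v w) (x :: p)].

Definition AN {R : realType} (V : countType) (nb : V -> seq V) (Omega : Type)
    (phi : V -> Omega -> R) (X : set V) (N : nat) (h : R) : set Omega :=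
  [set w | finite_set (cluster nb phi h X w) /\
     (N%:R - 1 <= cap (R := R) nb (closure_nb nb (cluster nb phi h X w)) < N%:R)].

(* (c_N) nonnegative and log(c_N)/log N -> -oo  (with log 0 = -oo) *)
Definition superpoly {R : realType} (c : nat -> R) : Prop :=
  (forall N, 0 <= c N) /\
  forall M : R, \forall N \near \oo, c N = 0 \/ ln (c N) / ln (N%:R) <= - M.

Definition hstar {R : realType} (V : countType) (nb : V -> seq V) d
    (Omega : measurableType d) (P : probability Omega R) (phi : V -> Omega -> R)
    (o : V) : \bar R :=
  ereal_sup (EFin @` [set h : R |
    (0 < P [set w | ~ finite_set (cluster nb phi h [set o] w)])%E]).

Definition tail_bound {R : realType} (V : countType) (nb : V -> seq V) d
    (Omega : measurableType d) (P : probability Omega R) (phi : V -> Omega -> R)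
    (H : R -> Prop) : Prop :=
  forall X : set V, finite_set X -> exists c : nat -> R, superpoly c /\
    forall (N : nat) (h' : R), (1 <= N)%N -> H h' -> (P (AN nb phi X N h') <= (c N)%:E)%E.

Definition htilde {R : realType} (V : countType) (nb : V -> seq V) d
    (Omega : measurableType d) (P : probability Omega R) (phi : V -> Omega -> R)
    (o : V) : \bar R :=
  ereal_sup (EFin @` [set h : R | (h%:E < hstar nb P phi o)%E /\
     tail_bound nb P phi (fun h' => h' <= h)]).

Definition hhat {R : realType} (V : countType) (nb : V -> seq V) d
    (Omega : measurableType d) (P : probability Omega R) (phi : V -> Omega -> R)
    (o : V) : \bar R :=
  ereal_inf (EFin @` [set h : R | (hstar nb P phi o < h%:E)%E /\
     tail_bound nb P phi (fun h' => h <= h')]).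

Definition poly_growth {R : realType} (V : countType) (nb : V -> seq V)
    (Fre Fim : set V -> R) : Prop :=
  exists C : R, forall S : set V, finite_set S ->
    Num.sqrt (Fre S ^+ 2 + Fim S ^+ 2) <= C * (1 + cap nb (closure_nb nb S)) `^ C.

Definition obs_rv {R : realType} (V : countType) (nb : V -> seq V) (Omega : Type)
    (phi : V -> Omega -> R) (F : set V -> R) (X : set V) (h : R) (w : Omega) : R :=
  F (cluster nb phi h X w) * \1_[set w' | finite_set (cluster nb phi h X w')] w.

Definition Fbar {R : realType} (V : countType) (nb : V -> seq V) d
    (Omega : measurableType d) (P : probability Omega R) (phi : V -> Omega -> R)
    (F : set V -> R) (X : set V) (h : R) : R :=
  fine (\int[P]_w (obs_rv nb phi F X h w)%:E)%E.

Definition smooth_on {R : realType} (U : set R) (f : R -> R) : Prop :=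
  exists fs : nat -> R -> R, fs 0%N = f /\
    forall (k : nat) (h : R), U h -> is_derive h 1 (fs k) (fs k.+1 h).

(* Main.v *)
(** For finite S let f_S(t) be the probability that the cluster of X at height t
    is S. This event depends on the field on K, the union of X and of the closure
    of S, so by the Cameron-Martin formula f_S(t) = E[1_A exp(- t M - c t^2 / 2)]
    where A is the event at height 0, M is the field integrated against the
    equilibrium measure of K, and c = cap(K) <= cap(closure S) + cap(X).

    Differentiating j times at t produces at most j factors of size |M + c t|. If
    c r^2 <= 1, these factors cost r^(-j), after which
    exp(2 r |M + c u|) is absorbed into the two shifts u - 2 r and u + 2 r: the
    j-th derivative near u is at most C_j r^(-j) (f_S(u + 2 r) + f_S(u - 2 r)).
    Taking r of order 1/N for all S of capacity about N, and a grid of mesh r,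
    bounds the contribution of these S to any derivative, uniformly over a
    neighbourhood, by a polynomial in N times the super-polynomially small bound on
    the probability that the cluster has capacity about N. Hence the series
    sum_S F(S) f_S(t) can be differentiated term by term.

    As the field is only known through the laws of its linear combinations, the
    Cameron-Martin formula is obtained by comparing moment generating functions,
    one coordinate at a time. *)

Require Import Defs.
From HB Require Import structures.
From mathcomp Require Import all_boot all_order all_algebra.
From mathcomp Require Import finmap.
From mathcomp Require Import all_classical all_reals all_analysis.
From mathcomp Require Import measurable_realfun.
From mathcomp Require Import ring lra.
Set Implicit Arguments.
Unset Strict Implicit.
Unset Printing Implicit Defensive.
Import Order.TTheory GRing.Theory Num.Theory.
Import numFieldNormedType.Exports.
Local Open Scope classical_set_scope.
Local Open Scope ring_scope.

(** * Random walk and equilibrium measure *)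

(** The Green potential of the equilibrium measure of K equals 1 on K. Changing the height is a
    constant shift of the field on K, hence a Cameron-Martin shift whose density involves only M,
    and the variance of M is cap(K). Clusters are never counted: at a fixed height the events that
    the cluster equals S are disjoint, so the f_S(t) with S at one capacity level sum to at most the
    probability of that level. The obstacle is that termwise differentiation wants a supremum over t
    inside the sum over S, where disjointness is lost. Since the shifted heights u + 2 r and u - 2 r
    do not depend on t, and the grid of the u depends on S only through its level, disjointness can
    be used at order N fixed heights. A mesh of order N^(-1/2) would already give c r^2 <= 1; taking
    1/N avoids square roots and costs only powers of N. As heights move both up and down, tail
    bounds are needed on a full neighbourhood of the height considered, which both thresholds
    provide on their outer sides. *)

Lemma cvg_seq_sum (R : realType) (I : Type) (s : seq I) (f : I -> nat -> R)
    (l : I -> R) : (forall i, f i @ \oo --> l i) ->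
  (fun n => \sum_(i <- s) f i n) @ \oo --> \sum_(i <- s) l i.
Proof.
move=> fl; elim: s => [|i s IH].
  by under eq_fun do rewrite big_nil; rewrite big_nil; exact: cvg_cst.
under eq_fun do rewrite big_cons; rewrite big_cons.
exact: cvgD.
Qed.

(** For all but the last [m] indices the factor [u (N - n)] is close to [l]; on the remaining ones
    it is at most [u 0], while [p] has a small tail there. It will be applied to visit probabilities
    against the probabilities of no return up to time [N]. *)
Lemma cvg_convolution (R : realType) (p u : R ^nat) (l : R) :
  (forall n, 0 <= p n) -> cvgn (series p) ->
  nonincreasing_seq u -> u @ \oo --> l ->
  (fun N => \sum_(0 <= n < N.+1) p n * u (N - n)%N) @ \oo -->
  limn (series p) * l.
Proof.
move=> p0 cp du cu; set G := limn (series p).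
have ul n : l <= u n.
  have -> : l = limn u by apply/esym/cvg_lim.
  by apply: nonincreasing_cvgn_ge => //; apply/cvg_ex; exists l.
have pG n : series p n <= G.
  apply: nondecreasing_cvgn_le => //.
  by apply: nondecreasing_series => i _ _.
have G0 : 0 <= G by have := pG 0%N; rewrite seriesEnat /= big_geq.
apply/cvgrPdist_le => e e0.
(* [M] collects the coefficients of the errors: [G] goes with the error on [u], and [l] and [u 0]
   with the tail of [p]. *)
pose M := G + `|l| + `|u 0%N| + 1.
have M0 : 0 < M by rewrite /M; have := normr_ge0 l; have := normr_ge0 (u 0%N); lra.
have d0 : 0 < e / (M *+ 2) by rewrite divr_gt0// mulrn_wgt0.
move/cvgrPdist_le : (cu) => /(_ _ d0)[m _ /= um].
move/cvgrPdist_le : (cp) => /(_ _ d0)[m' _ /= pm].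
exists (m + m')%N => // N /= mN.
have lo : series p N.+1 * l <= \sum_(0 <= n < N.+1) p n * u (N - n)%N.
  rewrite seriesEnat /= mulr_suml; apply: ler_sum => i _.
  by apply: ler_wpM2l.
have hi : \sum_(0 <= n < N.+1) p n * u (N - n)%N <=
    series p (N - m).+1 * u m + (series p N.+1 - series p (N - m).+1) * u 0%N.
  rewrite sub_series_geq ?ltnS ?leq_subr// seriesEnat /=.
  rewrite (@big_cat_nat _ _ _ (N - m).+1) ?ltnS ?leq_subr//=.
  rewrite !mulr_suml; apply: lerD; rewrite !big_nat; apply: ler_sum => i.
    move=> /andP[_ iN]; apply: ler_wpM2l => //; apply: du.
    rewrite ltnS in iN; rewrite leq_subRL ?(leq_trans iN) ?leq_subr//.
    by rewrite addnC -leq_subRL// (leq_trans _ mN)// leq_addr.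
  by move=> _; apply: ler_wpM2l => //; apply: du.
have N1 : (m' <= N.+1)%N by rewrite (leq_trans _ (leqnSn _))// (leq_trans _ mN)// leq_addl.
have N2 : (m' <= (N - m).+1)%N by rewrite leqW// leq_subRL// (leq_trans _ mN)// leq_addr.
have := pm _ N1; have := pm _ N2; have := um _ (leqnn m).
have := pG N.+1; have := pG (N - m).+1; have := ul m; have := ul 0%N.
have s0 : 0 <= series p (N - m).+1 by rewrite seriesEnat /= sumr_ge0.
have s01 : series p (N - m).+1 <= series p N.+1.
  by apply: nondecreasing_series => //; rewrite ltnS leq_subr.
move: lo hi s0 s01; set A := series p N.+1; set B := series p (N - m).+1.
set T := \sum_(_ <= _ < _) _.
rewrite -/G => lo hi s0 s01 u0l uml BG AG.
rewrite [ `|l - u m|]ler0_norm ?subr_le0// opprB.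
rewrite ![ `|G - _|]ger0_norm ?subr_ge0//.
set dl := e / (M *+ 2) => h1 h2 h3.
have eM : e = dl * M * 2 by rewrite /dl -mulr_natr; field; rewrite gt_eqF.
have U0 : u 0%N <= `|u 0%N| by exact: ler_norm.
have L0 : l <= `|l| by exact: ler_norm.
have L1 : - `|l| <= l by have := ler_norm (- l); rewrite normrN; lra.
have L2 := normr_ge0 l; have U2 := normr_ge0 (u 0%N).
rewrite ler_norml; apply/andP; split; rewrite eM /M.
  have b1 : B * u m <= B * (l + dl) by apply: ler_wpM2l => //; lra.
  have b2 : (A - B) * u 0%N <= dl * `|u 0%N|.
    apply: (@le_trans _ _ ((A - B) * `|u 0%N|)); first by apply: ler_wpM2l => //; lra.
    by apply: ler_wpM2r => //; lra.
  have b3 : B * dl <= G * dl by apply: ler_wpM2r => //; rewrite ltW.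
  have b4 : (B - G) * l <= dl * `|l|.
    have : (G - B) * (- l) <= (G - B) * `|l| by apply: ler_wpM2l; lra.
    have : (G - B) * `|l| <= dl * `|l| by apply: ler_wpM2r; lra.
    lra.
  have : 0 <= dl * G by rewrite mulr_ge0// ltW.
  have : 0 <= dl * `|l| by rewrite mulr_ge0// ltW.
  have : 0 <= dl * `|u 0%N| by rewrite mulr_ge0// ltW.
  have := ltW d0; rewrite -/dl; nra.
have b4 : (G - A) * l <= dl * `|l|.
  have : (G - A) * l <= (G - A) * `|l| by apply: ler_wpM2l; lra.
  have : (G - A) * `|l| <= dl * `|l| by apply: ler_wpM2r; lra.
  lra.
have : 0 <= dl * G by rewrite mulr_ge0// ltW.
have : 0 <= dl * `|l| by rewrite mulr_ge0// ltW.
have : 0 <= dl * `|u 0%N| by rewrite mulr_ge0// ltW.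
have := ltW d0; rewrite -/dl; nra.
Qed.

Section random_walk.
Variables (R : realType) (V : countType) (nb : V -> seq V).
Hypothesis sg : simple_graph nb.
Hypothesis gc : graph_connected nb.
Hypothesis tr : transient (R := R) nb.
Local Notation deg := (@deg R V nb).
Local Notation srw := (@srw R V nb).
Local Notation avoid := (@avoid R V nb).
Local Notation escN := (@escN R V nb).
Local Notation esc := (@esc R V nb).
Local Notation green := (@green R V nb).
Local Notation cap := (@cap R V nb).

Lemma deg_gt0 x : 0 < deg x.
Proof. by rewrite /Defs.deg ltr0n; case: (tr x). Qed.

Lemma deg_neq0 x : deg x != 0. Proof. by rewrite gt_eqF// deg_gt0. Qed.

Lemma avg_cst x (c : R) : (deg x)^-1 * \sum_(z <- nb x) c = c.
Proof.
by rewrite big_const_seq count_predT iter_addr_0 -mulr_natl mulrA mulVf ?mul1r ?deg_neq0.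
Qed.

Lemma avg_le x (f g : V -> R) : (forall z, f z <= g z) ->
  (deg x)^-1 * \sum_(z <- nb x) f z <= (deg x)^-1 * \sum_(z <- nb x) g z.
Proof.
move=> fg; rewrite ler_wpM2l ?invr_ge0 ?ler0n//.
by apply: ler_sum.
Qed.

Lemma srw_ge0 n x y : 0 <= srw n x y.
Proof.
elim: n x => [x|n IH x] /=; first by rewrite ler0n.
by rewrite mulr_ge0 ?invr_ge0 ?ler0n// sumr_ge0.
Qed.

Lemma nb_sym x y : (y \in nb x) = (x \in nb y).
Proof. by apply/idP/idP; [case: (sg x)|case: (sg y)] => _ [_]; apply. Qed.

(** [srw] unfolds at the first step, this form at the last one: [(deg z)^-1] is the probability of
    stepping from [z] to [y], and symmetry of [nb] lets the sum run over the neighbours of [y].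
    Playing the two forms against each other gives reversibility. *)
Lemma srwSr n x y :
  srw n.+1 x y = \sum_(z <- nb y) srw n x z * (deg z)^-1.
Proof.
have delta (a : V) (f : V -> R) (u : V) :
    \sum_(z <- nb a) (z == u)%:R * f z = (u \in nb a)%:R * f u.
  have [ua|ua] := boolP (u \in nb a).
    rewrite (bigD1_seq u)//=; last by case: (sg a).
    by rewrite eqxx big1 ?addr0// => i /negbTE ->; rewrite mul0r.
  rewrite mul0r big_seq big1// => i ia; case: eqP => [iu|_]; last by rewrite mul0r.
  by move: ua; rewrite -iu ia.
elim: n x => [x|n IH x].
  rewrite /=; under eq_bigr do rewrite -[(_ == _)%:R]mulr1.
  rewrite (delta x (fun=> 1) y) mulr1.
  under [RHS]eq_bigr do rewrite eq_sym.
  by rewrite (delta y (fun z => (deg z)^-1) x) nb_sym mulrC.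
rewrite [LHS](_ : _ = (deg x)^-1 * \sum_(z <- nb x) srw n.+1 z y)//.
rewrite (eq_bigr _ (fun z _ => IH z)) exchange_big /= mulr_sumr; apply: eq_bigr => w _.
by rewrite -mulr_suml mulrA.
Qed.

Lemma srw_reversible n x y : deg x * srw n x y = deg y * srw n y x.
Proof.
elim: n x y => [x y|n IH x y]; first by rewrite /= eq_sym; case: eqP => [->|]//; rewrite !mulr0.
rewrite [in RHS]srwSr /= mulVKf ?deg_neq0// mulr_sumr; apply: eq_bigr => z _.
by rewrite mulrA -IH mulrAC mulfV ?mul1r ?deg_neq0.
Qed.

Lemma srw_chain m n y x z : srw m y x * srw n x z <= srw (m + n) y z.
Proof.
elim: m y => [y|m IH y] /=.
  by case: eqP => [->|_]; rewrite ?mul1r// mul0r srw_ge0.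
rewrite -mulrA mulr_suml; apply: avg_le => w; exact: IH.
Qed.

Lemma srw_reach y x : exists k, 0 < srw k y x.
Proof.
have [p [yp px]] := gc y x.
elim: p y yp px => [y _ /= ->|w p IH y /= /andP[yw wp] px].
  by exists 0%N; rewrite /= eqxx.
have [k k0] := IH _ wp px; exists k.+1 => /=.
rewrite mulr_gt0 ?invr_gt0 ?deg_gt0//.
rewrite (bigD1_seq w)//=; last by case: (sg y).
by rewrite ltr_wpDr// sumr_ge0// => i _; rewrite srw_ge0.
Qed.

(** Transience speaks of the diagonal only. By connectedness some [k] steps lead from [y] back to
    [x] with positive probability, so a visit to [y] at time [n] is paid for by a return to [x] at
    time [n + k]. *)
Lemma is_cvg_srw x y : cvgn (series (fun n => srw n x y)).
Proof.
have [k k0] := srw_reach y x.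
have cx : cvgn (series (fun n => srw (n + k) x x)).
  case: (tr x) => _ cx.
  rewrite -(is_cvg_series_restrict k) in cx.
  have /cvg_ex[l cl] := cx; apply/cvg_ex; exists l.
  move: cl; rewrite -(cvg_shiftn k).
  apply: cvg_trans; apply: near_eq_cvg; apply: nearW => n.
  have := @big_addn _ 0 +%R 0%N (n + k)%N k xpredT (fun i => srw i x x).
  by rewrite add0n addnK seriesEnat /= => ->.
apply: (@series_le_cvg _ _ (fun n => (srw k y x)^-1 * srw (n + k) x x)).
- by move=> n; exact: srw_ge0.
- by move=> n; rewrite mulr_ge0 ?invr_ge0 ?srw_ge0.
- by move=> n; rewrite ler_pdivlMl// mulrC srw_chain.
- exact: (@is_cvg_seriesZ R (fun n => srw (n + k) x x) (srw k y x)^-1 cx).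
Qed.

Lemma green_sym x y : green x y = green y x.
Proof.
have e a b : green a b = limn (fun N => (deg b)^-1 * series (fun n => srw n a b) N).
  by apply/esym/cvg_lim => //; apply: cvgM; [exact: cvg_cst|exact: is_cvg_srw].
rewrite !e; congr (limn _); apply/funext => n.
rewrite !seriesEnat /= !mulr_sumr; apply: eq_bigr => i _.
apply: (mulfI (deg_neq0 x)); rewrite mulrCA srw_reversible !mulrA.
by rewrite mulVf ?mulfV ?deg_neq0.
Qed.

Lemma avoid_ge0 K n y : 0 <= avoid K n y.
Proof.
elim: n y => [y|n IH y] //=.
by rewrite !mulr_ge0 ?invr_ge0 ?ler0n// sumr_ge0.
Qed.

Lemma avoid_le K n y : avoid K n.+1 y <= avoid K n y.
Proof.
elim: n y => [y|n IH y].
  rewrite /= avg_cst mulr1; by case: (y \notin K); rewrite /= ?ler01.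
by rewrite /= ler_wpM2l ?ler0n//; apply: avg_le.
Qed.

Lemma avoid_subset (K L : set V) n y : K `<=` L -> avoid L n y <= avoid K n y.
Proof.
move=> KL; elim: n y => [y|n IH y] //=.
apply: ler_pM; rewrite ?ler0n//.
- by rewrite !mulr_ge0 ?invr_ge0 ?ler0n// sumr_ge0// => z _; exact: avoid_ge0.
- have [yL|yL] := boolP (y \notin L); rewrite ?ler0n//.
  suff -> : y \notin K by [].
  by move: yL; rewrite !notin_setE; exact: contra_not (KL y).
- exact: avg_le.
Qed.

Lemma escN_ge0 K n y : 0 <= escN K n y.
Proof.
rewrite /Defs.escN mulr_ge0 ?invr_ge0 ?ler0n// sumr_ge0// => z _.
exact: avoid_ge0.
Qed.

Lemma escN_decr K y : nonincreasing_seq (fun n => escN K n y).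
Proof.
apply/nonincreasing_seqP => n; apply: avg_le => z; exact: avoid_le.
Qed.

Lemma escN_cvg K y : (fun n => escN K n y) @ \oo --> esc K y.
Proof.
apply: nonincreasing_is_cvgn; first exact: escN_decr.
by exists 0 => _ [n _ <-]; exact: escN_ge0.
Qed.

Lemma esc_ge0 K y : 0 <= esc K y.
Proof.
apply: limr_ge; first by apply/cvg_ex; exists (esc K y); exact: escN_cvg.
by near=> n; exact: escN_ge0.
Unshelve. all: by end_near. Qed.

Lemma esc_subset (K L : set V) y : K `<=` L -> esc L y <= esc K y.
Proof.
move=> KL; apply: ler_lim.
- by apply/cvg_ex; exists (esc L y); exact: escN_cvg.
- by apply/cvg_ex; exists (esc K y); exact: escN_cvg.
- by near=> n; apply: avg_le => z; exact: avoid_subset.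
Unshelve. all: by end_near. Qed.

(* Decomposition according to the last visit to [s] up to time [N]. *)
Lemma last_exit_finite (s : seq V) N x : uniq s ->
  \sum_(y <- s) \sum_(0 <= n < N.+1) srw n x y * escN [set` s] (N - n) y =
  1 - avoid [set` s] N.+1 x.
Proof.
move=> us; elim: N x => [|N IH] x.
  under eq_bigr do rewrite big_nat1 subn0.
  rewrite /= avg_cst mulr1 mem_setE.
  under eq_bigr do rewrite /Defs.escN /= avg_cst mulr1.
  have [xs|xs] := boolP (x \in s).
    rewrite (bigD1_seq x)//= eqxx big1 ?addr0 ?subr0// => i.
    by rewrite eq_sym => /negbTE ->.
  rewrite big_seq big1 ?subrr// => i si; case: eqP => // xi.
  by rewrite xi si in xs.
set E := escN [set` s] N.+1 x.
have xE : (x \in [set` s]) = (x \in s) by rewrite mem_setE.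
have -> : avoid [set` s] N.+2 x = (x \notin s)%:R * E by rewrite -xE.
under eq_bigr do rewrite big_nat_recl//= subn0.
rewrite big_split /=.
have -> : \sum_(y <- s) \sum_(0 <= n < N.+1)
    (deg x)^-1 * (\sum_(z <- nb x) srw n z y) * escN [set` s] (N.+1 - n.+1) y =
  (deg x)^-1 * \sum_(z <- nb x) (1 - avoid [set` s] N.+1 z).
  under [in RHS]eq_bigr do rewrite -IH.
  rewrite [in RHS]exchange_big /= mulr_sumr; apply: eq_bigr => y _.
  rewrite [in RHS]exchange_big /= mulr_sumr; apply: eq_bigr => n _.
  by rewrite subSS -mulrA mulr_suml.
rewrite sumrB mulrBr avg_cst.
change ((deg x)^-1 * \sum_(z <- nb x) avoid [set` s] N.+1 z) with E.
have -> : \sum_(i <- s) (x == i)%:R * escN [set` s] N.+1 i = (x \in s)%:R * E.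
  have [xs|xs] := boolP (x \in s).
    rewrite (bigD1_seq x)//= eqxx big1 ?addr0 ?mul1r// => i.
    by rewrite eq_sym => /negbTE ->; rewrite mul0r.
  rewrite mul0r big_seq big1// => i si; case: eqP => [xi|_]; last by rewrite mul0r.
  by rewrite xi si in xs.
by case: (x \in s); rewrite /= ?mul0r ?mul1r; ring.
Qed.

(** A transient walk started in [s] has a last visit to [s]: this is the limit of the finite
    decomposition, whose right-hand side is 1 as time 0 is already a visit. In other words, the
    equilibrium measure has Green potential 1 on [s], which makes constant shifts of the field
    tractable. *)
Lemma last_exit (s : seq V) x : uniq s -> x \in s ->
  \sum_(y <- s) green x y * (deg y * esc [set` s] y) = 1.
Proof.
move=> us xs.
have e1 : (fun N => \sum_(y <- s) \sum_(0 <= n < N.+1)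
    srw n x y * escN [set` s] (N - n) y) @ \oo --> (1 : R).
  under eq_fun do rewrite last_exit_finite//= mem_setE xs mul0r subr0.
  exact: cvg_cst.
have e2 : (fun N => \sum_(y <- s) \sum_(0 <= n < N.+1)
    srw n x y * escN [set` s] (N - n) y) @ \oo -->
    \sum_(y <- s) green x y * (deg y * esc [set` s] y).
  apply: cvg_seq_sum => y.
  rewrite mulrA /Defs.green (mulrC (deg y)^-1) -(mulrA _ _ (deg y)) mulVf ?deg_neq0// mulr1.
  apply: (@cvg_convolution R (fun n => srw n x y) (fun n => escN [set` s] n y)).
  - by move=> n; exact: srw_ge0.
  - exact: is_cvg_srw.
  - exact: escN_decr.
  - exact: escN_cvg.
exact: cvg_unique e2 e1.
Qed.

Lemma cap_seqE (s : seq V) : uniq s ->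
  cap [set` s] = \sum_(y <- s) deg y * esc [set` s] y.
Proof. by move=> us; rewrite /Defs.cap -fsbig_seq. Qed.

Lemma cap_ge0 (K : set V) : 0 <= cap K.
Proof.
rewrite /Defs.cap fsumr_ge0// => x _.
by rewrite mulr_ge0 ?ler0n ?esc_ge0.
Qed.

(** Escaping from a larger set is less likely, so each point of the union contributes at most its
    share in [K], or its share in [L] when it lies outside [K]. *)
Lemma cap_setU (K L : set V) : finite_set K -> finite_set L ->
  cap (K `|` L) <= cap K + cap L.
Proof.
move=> fK fL.
have t x (A : set V) : 0 <= deg x * esc A x by rewrite mulr_ge0 ?ler0n ?esc_ge0.
have mono x (A B : set V) : A `<=` B -> deg x * esc B x <= deg x * esc A x.
  by move=> AB; rewrite ler_wpM2l ?ler0n// esc_subset.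
have fKL : finite_set (K `|` L) by rewrite finite_setU.
rewrite /Defs.cap (fsbigID K)// setUK; apply: lerD.
  rewrite !fsbig_finite//=; apply: ler_sum => x _.
  by apply: mono; exact: subsetUl.
rewrite [leRHS](fsbigID (~` K))// setIUl setICr set0U.
rewrite -[leLHS]addr0; apply: lerD; last exact: fsumr_ge0.
have fLK : finite_set (L `&` ~` K) by apply: finite_setIl.
rewrite !fsbig_finite//=; apply: ler_sum => x _.
by apply: mono; exact: subsetUr.
Qed.

End random_walk.

(** * A real law with exponential moments is determined by its moment generating function *)

Lemma exprn_le_fact_expR (R : realType) (n : nat) (x : R) : 0 <= x ->
  x ^+ n <= n`!%:R * expR x.
Proof.
move=> x0; case: n => [|n]; first by rewrite expr0 fact0 mul1r -expR0 ler_expR.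
have := expR_ge1Dxn n x0; rewrite -ler_pdivrMl ?ltr0n ?fact_gt0// mulrC.
lra.
Qed.

Lemma expR_norm_le (R : realType) (x : R) : expR `|x| <= expR x + expR (- x).
Proof.
have [x0|x0] := leP 0 x; first by rewrite ger0_norm// lerDl expR_ge0.
by rewrite ltr0_norm// lerDr expR_ge0.
Qed.

Lemma series_exp_coeff_le (R : realType) (x : R) n : 0 <= x ->
  series (exp_coeff x) n <= expR x.
Proof.
move=> x0; apply: nondecreasing_cvgn_le; last exact: is_cvg_series_exp_coeff.
by apply: nondecreasing_series => i _ _; exact: exp_coeff_ge0.
Qed.

Lemma expRB1_bounds (R : realType) (y : R) : y <= expR y - 1 <= y * expR y.
Proof.
have h1 := expR_ge1Dx y; have h2 := expR_ge1Dx (- y).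
apply/andP; split; first lra.
have h3 : (1 + - y) * expR y <= 1.
  have e : expR (- y) * expR y = 1 by rewrite mulrC expRxMexpNx_1.
  by rewrite -[leRHS]e ler_wpM2r ?expR_ge0.
by move: h3; rewrite mulrDl mul1r; lra.
Qed.

Section moment_generating_function.
Context d (T : measurableType d) (R : realType) (mu : {measure set T -> \bar R}).
Variables (W1 W2 Y1 Y2 : T -> R).

(* Equality of the means of exponentials passes to x^k exp(a x) by difference
   quotients, to sines by power series, to polynomials in a sine by the product
   formula, and then to the signs of x - b. *)
Definition same_mean (f : R -> R) : Prop :=
  [/\ mu.-integrable setT (fun w => (W1 w * f (Y1 w))%:E),
      mu.-integrable setT (fun w => (W2 w * f (Y2 w))%:E) &
      \int[mu]_w (W1 w * f (Y1 w)) = \int[mu]_w (W2 w * f (Y2 w))].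

Lemma same_meanD f g : same_mean f -> same_mean g ->
  same_mean (fun x => f x + g x).
Proof.
move=> [f1 f2 fe] [g1 g2 ge].
have E (W Y : T -> R) : (fun w => (W w * (f (Y w) + g (Y w)))%:E) =
    (fun w => (W w * f (Y w))%:E + (W w * g (Y w))%:E)%E.
  by apply/funext => w; rewrite mulrDr EFinD.
split; rewrite ?E; [exact: integrableD|exact: integrableD|].
under eq_Rintegral do rewrite mulrDr; under [RHS]eq_Rintegral do rewrite mulrDr.
by rewrite !RintegralD// fe ge.
Qed.

Lemma same_meanZ c f : same_mean f -> same_mean (fun x => c * f x).
Proof.
move=> [f1 f2 fe].
have E (W Y : T -> R) : (fun w => (W w * (c * f (Y w)))%:E) =
    (fun w => c%:E * (W w * f (Y w))%:E)%E.
  by apply/funext => w; rewrite mulrCA EFinM.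
split; rewrite ?E; [exact: integrableZl|exact: integrableZl|].
under eq_Rintegral do rewrite mulrCA; under [RHS]eq_Rintegral do rewrite mulrCA.
by rewrite !RintegralZl// fe.
Qed.

Lemma same_mean_ext f g : f =1 g -> same_mean f -> same_mean g.
Proof. by move=> fg; rewrite (funext fg). Qed.

Lemma same_meanB f g : same_mean f -> same_mean g ->
  same_mean (fun x => f x - g x).
Proof.
move=> sf sg; apply: (@same_mean_ext (fun x => f x + -1 * g x)).
  by move=> x; rewrite mulN1r.
by apply: same_meanD => //; exact: same_meanZ.
Qed.

Lemma same_mean_sum (f : nat -> R -> R) n : same_mean (cst 0) ->
  (forall i, same_mean (f i)) ->
  same_mean (fun x => \sum_(0 <= i < n) f i x).
Proof.
move=> s0 sf; elim: n => [|n IH].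
  by apply: same_mean_ext s0 => x; rewrite big_geq.
apply: (@same_mean_ext (fun x => (\sum_(0 <= i < n) f i x) + f n x)).
  by move=> x; rewrite big_nat_recr.
exact: same_meanD.
Qed.

Hypothesis W1_ge0 : forall w, 0 <= W1 w.
Hypothesis W2_ge0 : forall w, 0 <= W2 w.

(** Dominated convergence under both weighted laws at once. The dominating function is itself taken
    from the class, which supplies its integrability on both sides. *)
Lemma same_mean_lim (f_ : nat -> R -> R) (f g : R -> R) : (forall n, same_mean (f_ n)) ->
  (forall x, f_ ^~ x @ \oo --> f x) ->
  same_mean g -> (forall n x, `|f_ n x| <= g x) -> same_mean f.
Proof.
move=> sf fl [g1 g2 _] fg.
have E (W Y : T -> R) : (forall w, 0 <= W w) ->
    (forall n, mu.-integrable setT (fun w => (W w * f_ n (Y w))%:E)) ->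
    mu.-integrable setT (fun w => (W w * g (Y w))%:E) ->
    mu.-integrable setT (fun w => (W w * f (Y w))%:E) /\
    (fun n => \int[mu]_w (W w * f_ n (Y w))) @ \oo --> \int[mu]_w (W w * f (Y w)).
  move=> W0 i_ ig.
  have mf n : measurable_fun [set: T] (fun w => (W w * f_ n (Y w))%:E).
    exact: measurable_int (i_ n).
  have cv w : (fun n => (W w * f_ n (Y w))%:E) @ \oo --> (W w * f (Y w))%:E.
    by apply: cvg_EFin; [exact: nearW|apply: cvgM => //; exact: cvg_cst].
  have [||||i _ c] := @dominated_convergence _ _ _ mu _ measurableT _
      (fun w => (W w * f (Y w))%:E) (fun w => (W w * g (Y w))%:E) mf.
  - exact: (emeasurable_fun_cvg _ _ mf).
  - exact: aeW.
  - exact: ig.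
  - by apply: aeW => w n _; rewrite lee_fin normrM ger0_norm// ler_wpM2l.
  split=> //; apply: fine_cvg; rewrite fineK//.
  exact: integrable_fin_num.
have [i1 c1] := E _ _ W1_ge0 (fun n => let: And3 h _ _ := sf n in h) g1.
have [i2 c2] := E _ _ W2_ge0 (fun n => let: And3 _ h _ := sf n in h) g2.
split=> //; apply: cvg_unique c1 _ => //.
have -> : (fun n => \int[mu]_w (W1 w * f_ n (Y1 w))) =
    (fun n => \int[mu]_w (W2 w * f_ n (Y2 w))).
  by apply/funext => n; case: (sf n).
exact: c2.
Qed.

Hypothesis same_exp : forall a, same_mean (fun x => expR (a * x)).

Lemma same_mean_cst c : same_mean (cst c).
Proof.
apply: (@same_mean_ext (fun x => c * expR (0 * x))); last exact: same_meanZ.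
by move=> x; rewrite mul0r expR0 mulr1.
Qed.

Lemma same_mean_cosh c a : same_mean (fun x => c * (expR (a * x) + expR (- a * x))).
Proof. by apply: same_meanZ; exact: same_meanD. Qed.

Lemma same_mean_exprn_exp k a : same_mean (fun x => x ^+ k * expR (a * x)).
Proof.
elim: k a => [a|k IH a].
  by apply: same_mean_ext (same_exp a) => x; rewrite mul1r.
pose dl n : R := n.+1%:R^-1.
have dl0 n : 0 < dl n by rewrite invr_gt0.
have dl1 n : dl n <= 1 by rewrite invf_le1// ler1n.
pose f_ n x := (dl n)^-1 * (x ^+ k * expR ((a + dl n) * x) - x ^+ k * expR (a * x)).
have fE n x : f_ n x = x ^+ k * expR (a * x) * ((expR (dl n * x) - 1) / dl n).
  rewrite /f_ mulrDl expRD; field; exact: lt0r_neq0.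
(* One unit of the 2 pays for the factor [expR |x|] of the difference quotient, the other for
   [|x| ^+ k.+1], bounded by a factorial times [expR |x|]. *)
pose c := `|a| + 2.
apply: (@same_mean_lim f_ _ (fun x => (k.+1)`!%:R * (expR (c * x) + expR (- c * x)))).
- by move=> n; apply: same_meanZ; exact: same_meanB.
- move=> x; under eq_fun do rewrite fE.
  rewrite exprSr mulrAC; apply: cvgM; first exact: cvg_cst.
  have dx : (fun n => expR (dl n * x)) @ \oo --> (1 : R).
    have h : (fun n => dl n * x) @ \oo --> 0 * x.
      by apply: cvgM; [exact: cvg_harmonic|exact: cvg_cst].
    by rewrite -expR0 -(mul0r x); apply: continuous_cvg h; exact: continuous_expR.
  apply: (@squeeze_cvgr _ _ _ _ (fun=> x) (fun n => x * expR (dl n * x))).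
  + apply: nearW => n /=; have /andP[h1 h2] := expRB1_bounds (dl n * x).
    apply/andP; split; first by rewrite ler_pdivlMr// mulrC.
    by rewrite ler_pdivrMr// mulrAC (mulrC x).
  + exact: cvg_cst.
  + by rewrite -[X in _ --> X]mulr1; apply: cvgM => //; exact: cvg_cst.
- exact: same_mean_cosh.
- move=> n x; rewrite fE.
  have h3 : `|(expR (dl n * x) - 1) / dl n| <= `|x| * expR `|x|.
    have /andP[h1 h2] := expRB1_bounds (dl n * x).
    rewrite normrM [ `|_^-1|]gtr0_norm ?invr_gt0// ler_pdivrMr//.
    have e1 : expR (dl n * x) <= expR `|x|.
      rewrite ler_expR (le_trans (ler_norm _))// normrM gtr0_norm//.
      by rewrite ler_piMl.
    have e2 : 1 <= expR `|x| by rewrite -expR0 ler_expR.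
    have dx : `|dl n * x| = `|x| * dl n by rewrite normrM gtr0_norm// mulrC.
    rewrite mulrAC -dx ler_norml; apply/andP; split.
      apply: le_trans h1; rewrite lerNl.
      apply: (@le_trans _ _ `|dl n * x|); first by rewrite -normrN ler_norm.
      by rewrite ler_peMr.
    apply: (le_trans h2); apply: (@le_trans _ _ (`|dl n * x| * expR (dl n * x))).
      by rewrite ler_wpM2r ?expR_ge0// ler_norm.
    by rewrite ler_wpM2l.
  rewrite normrM normrM normrX [ `|expR _|]ger0_norm ?expR_ge0//.
  have h4 : expR (a * x) <= expR (`|a| * `|x|) by rewrite ler_expR -normrM ler_norm.
  apply: (@le_trans _ _ (`|x| ^+ k * expR (`|a| * `|x|) * (`|x| * expR `|x|))).
    by apply: ler_pM => //; rewrite ?mulr_ge0 ?exprn_ge0 ?expR_ge0// ler_wpM2l// exprn_ge0.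
  have -> : `|x| ^+ k * expR (`|a| * `|x|) * (`|x| * expR `|x|) =
      `|x| ^+ k.+1 * expR ((`|a| + 1) * `|x|).
    by rewrite mulrDl mul1r expRD exprSr; ring.
  apply: (@le_trans _ _ ((k.+1)`!%:R * expR `|x| * expR ((`|a| + 1) * `|x|))).
    by rewrite ler_wpM2r ?expR_ge0//; exact: exprn_le_fact_expR.
  rewrite -mulrA ler_wpM2l// -expRD.
  have -> : `|x| + (`|a| + 1) * `|x| = `|c * x|.
    rewrite normrM [ `|c|]ger0_norm; first by rewrite /c; ring.
    by rewrite /c addr_ge0.
  by rewrite mulNr; exact: expR_norm_le.
Qed.

Lemma same_mean_exprn k : same_mean (fun x => x ^+ k).
Proof.
by apply: same_mean_ext (same_mean_exprn_exp k 0) => x; rewrite mul0r expR0 mulr1.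
Qed.

(** Partial sums are polynomials in [x], and comparison with the exponential series dominates all of
    them by [expR |t * x|], hence by a sum of two exponentials of the class. *)
Lemma same_mean_power_series (f : R -> R) (u : R -> nat -> R) t :
  (forall x n, `|u x n| <= exp_coeff `|x| n) ->
  (forall n, exists c, forall x, u (t * x) n = c * x ^+ n) ->
  (forall x, series (u x) @ \oo --> f x) ->
  same_mean (fun x => f (t * x)).
Proof.
move=> ub uX uf.
apply: (@same_mean_lim (fun n x => series (u (t * x)) n) _
    (fun x => 1 * (expR (t * x) + expR (- t * x)))).
- move=> n; under eq_fun do rewrite seriesEnat /=.
  apply: same_mean_sum; first exact: same_mean_cst.
  move=> i; have [c uc] := uX i.
  apply: (@same_mean_ext (fun x => c * x ^+ i)); first by move=> x; rewrite uc.
  by apply: same_meanZ; exact: same_mean_exprn.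
- by move=> x; exact: uf.
- exact: same_mean_cosh.
- move=> n x; rewrite mul1r mulNr; apply: le_trans (expR_norm_le _).
  apply: le_trans (series_exp_coeff_le n (normr_ge0 (t * x))).
  rewrite !seriesEnat /=; apply: (le_trans (ler_norm_sum _ _ _)).
  by apply: ler_sum.
Qed.

Lemma same_mean_sin t c : same_mean (fun x => sin (t * x + c)).
Proof.
have b (b : bool) m (y : R) n : `|b%:R * (-1) ^+ m * y ^+ n / n`!%:R| <= exp_coeff `|y| n.
  rewrite /exp_coeff /= !normrM normfV normrX [ `|n`!%:R|]ger0_norm//.
  rewrite normrN1 expr1n mulr1 -mulrA normrX -[leRHS]mul1r.
  by apply: ler_wpM2r; [rewrite divr_ge0 ?exprn_ge0|case: b; rewrite ?normr1 ?normr0].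
have s1 : same_mean (fun x => sin (t * x)).
  apply: (@same_mean_power_series _ (@sin_coeff R)).
  - by move=> x n; exact: b.
  - move=> n; exists ((odd n)%:R * (-1) ^+ n.-1./2 * t ^+ n / n`!%:R) => x.
    by rewrite /sin_coeff /= exprMn; ring.
  - by move=> x; rewrite unlock; exact: is_cvg_series_sin_coeff.
have s2 : same_mean (fun x => cos (t * x)).
  apply: (@same_mean_power_series _ (@cos_coeff R)).
  - by move=> x n; exact: b.
  - move=> n; exists ((~~ odd n)%:R * (-1) ^+ n./2 * t ^+ n / n`!%:R) => x.
    by rewrite /cos_coeff /= exprMn -!mulrA; do 3!congr (_ * _); rewrite mulrC.
  - by move=> x; rewrite unlock; exact: is_cvg_series_cos_coeff.
apply: (@same_mean_ext (fun x => cos c * sin (t * x) + sin c * cos (t * x))).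
  by move=> x; rewrite sinD; ring.
by apply: same_meanD; exact: same_meanZ.
Qed.

(** A product of two sines is half a difference of cosines, and cosines are sines with phase shifted
    by [pi / 2]. The free frequency and phase of the last factor let the induction absorb one sine
    at a time. *)
Lemma same_mean_sin_exprn t0 c0 n t c :
  same_mean (fun x => sin (t0 * x + c0) ^+ n * sin (t * x + c)).
Proof.
elim: n t c => [t c|n IH t c].
  by apply: same_mean_ext (same_mean_sin t c) => x; rewrite mul1r.
pose g (s e x : R) := sin (t0 * x + c0) ^+ n * sin (s * x + e).
apply: (@same_mean_ext (fun x => 2^-1 * (g (t0 - t) (c0 - c + pi / 2) x -
    g (t0 + t) (c0 + c + pi / 2) x))).
  move=> x; rewrite /g.
  have -> : (t0 - t) * x + (c0 - c + pi / 2) = (t0 * x + c0) - (t * x + c) + pi / 2 by ring.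
  have -> : (t0 + t) * x + (c0 + c + pi / 2) = (t0 * x + c0) + (t * x + c) + pi / 2 by ring.
  have sq (y : R) : sin (y + pi / 2) = cos y.
    by rewrite sinD cos_pihalf sin_pihalf mulr0 add0r mulr1.
  by rewrite !sq cosB [in X in _ - X]cosD exprSr; field.
by apply: same_meanZ; apply: same_meanB; exact: IH.
Qed.

Lemma same_mean_poly_sin t c (p : {poly R}) : same_mean (fun x => p.[sin (t * x + c)]).
Proof.
(* The extra factor [sin (0 * x + pi / 2)] is 1; it gives pure powers the shape treated above. *)
apply: (@same_mean_ext (fun x => \sum_(0 <= i < size p)
    p`_i * (sin (t * x + c) ^+ i * sin (0 * x + pi / 2)))).
  move=> x; rewrite horner_coef big_mkord; apply: eq_bigr => i _.
  by rewrite mul0r add0r sin_pihalf mulr1.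
apply: same_mean_sum; first exact: same_mean_cst.
by move=> i; apply: same_meanZ; exact: same_mean_sin_exprn.
Qed.

(* Iterating [u |-> (3 u - u^3) / 2], which maps [-1, 1] to itself, converges to
   the sign of [u]. *)
Fixpoint sign_poly n : {poly R} :=
  if n is m.+1 then (3 / 2) *: sign_poly m - 2^-1 *: sign_poly m ^+ 3 else 'X.

Lemma sign_polyE n u : (sign_poly n.+1).[u] =
  3 / 2 * (sign_poly n).[u] - 2^-1 * (sign_poly n).[u] ^+ 3.
Proof. by rewrite /= !hornerE. Qed.

Lemma sign_polyN n u : (sign_poly n).[- u] = - (sign_poly n).[u].
Proof.
elim: n => [|n IH]; first by rewrite /= !hornerX.
by rewrite !sign_polyE IH; ring.
Qed.

(** If [v] is an iterate, the next gap to 1 is [(1 - v) * (1 - (v + v ^+ 2) / 2)]. As iterates stay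
    above [u], the gap shrinks each time by a factor at most [1 - u / 2]. *)
Lemma sign_poly_gt0 n u : 0 < u <= 1 ->
  u <= (sign_poly n).[u] <= 1 /\ 1 - (sign_poly n).[u] <= (1 - u / 2) ^+ n.
Proof.
move=> /andP[u0 u1]; elim: n => [|n [/andP[h1 h2] h3]].
  by rewrite /= hornerX lexx u1 expr0; split => //; lra.
rewrite sign_polyE; move: h1 h2 h3; set v := (sign_poly n).[u] => h1 h2 h3.
have v0 : 0 <= v by lra.
have vv : 0 <= v * (1 - v) by rewrite mulr_ge0// subr_ge0.
split.
  apply/andP; split.
    have : 0 <= v * (1 - v) * (1 + v) by rewrite mulr_ge0// addr_ge0.
    nra.
  have : 0 <= (1 - v) * (1 - v) * (2 + v) by rewrite mulr_ge0 ?addr_ge0// -expr2 sqr_ge0.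
  nra.
rewrite [leRHS]exprSr.
have -> : 1 - (3 / 2 * v - 2^-1 * v ^+ 3) = (1 - v) * (1 - (v + v ^+ 2) / 2) by field.
apply: ler_pM; rewrite ?subr_ge0//.
- by rewrite ler_pdivrMr// mul1r; nra.
- by rewrite lerD2l lerN2 ler_pM2r ?invr_gt0//; have := sqr_ge0 v; lra.
Qed.

Lemma sign_poly_cvg u : `|u| <= 1 ->
  (forall n, `|(sign_poly n).[u]| <= 1) /\
  (fun n => (sign_poly n).[u]) @ \oo --> Num.sg u.
Proof.
have pos v : 0 < v <= 1 -> (forall n, `|(sign_poly n).[v]| <= 1) /\
    (fun n => (sign_poly n).[v]) @ \oo --> Num.sg v.
  move=> v01; have /andP[v0 v1] := v01; split.
    move=> n; have [/andP[h1 h2] _] := sign_poly_gt0 n v01.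
    by rewrite ger0_norm// (le_trans (ltW v0)).
  rewrite gtr0_sg//.
  apply: (@squeeze_cvgr _ _ _ _ (fun n => 1 - (1 - v / 2) ^+ n) (cst 1)).
  - apply: nearW => n /=; have [/andP[_ ->] h] := sign_poly_gt0 n v01.
    by rewrite andbT; lra.
  - rewrite -[X in _ --> X]subr0; apply: cvgB; first exact: cvg_cst.
    by apply: cvg_expr; rewrite ger0_norm; lra.
  - exact: cvg_cst.
move=> u1; have [u0|u0|->] := ltgtP u 0.
- rewrite -[u]opprK; have [|h1 h2] := pos (- u).
    by rewrite oppr_gt0 u0 /= -ltr0_norm.
  split; first by move=> n; rewrite sign_polyN normrN.
  under eq_fun do rewrite sign_polyN; rewrite sgrN; exact: cvgN.
- by apply: pos; rewrite u0 -(gtr0_norm u0).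
- have e n : (sign_poly n).[0] = 0.
    by have := sign_polyN n 0; rewrite oppr0; lra.
  by split=> [n|]; [rewrite e normr0|under eq_fun do rewrite e; rewrite sgr0; exact: cvg_cst].
Qed.

Lemma same_mean_sg_sin t c : same_mean (fun x => Num.sg (sin (t * x + c))).
Proof.
apply: (@same_mean_lim (fun n x => (sign_poly n).[sin (t * x + c)]) _ (cst 1)).
- by move=> n; exact: same_mean_poly_sin.
- by move=> x; apply: (sign_poly_cvg _).2; exact: sin_max.
- exact: same_mean_cst.
- by move=> n x; apply: (sign_poly_cvg _).1; exact: sin_max.
Qed.

Lemma normr_sg_le1 (x : R) : `|Num.sg x| <= 1.
Proof. by rewrite normr_sg; case: (x != 0). Qed.

(** Slowing the sine down unfolds its periodicity: once [|x - b| < n], the number [(x - b) / n.+1]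
    lies in []-1, 1[], where the sine has the sign of its argument. *)
Lemma same_mean_sg b : same_mean (fun x => Num.sg (x - b)).
Proof.
pose t n : R := n.+1%:R^-1.
apply: (@same_mean_lim (fun n x => Num.sg (sin (t n * x + - (t n * b)))) _ (cst 1)).
- by move=> n; exact: same_mean_sg_sin.
- move=> x; apply: cvg_near_cst; near=> n.
  rewrite -mulrN -mulrDr.
  have t0 : 0 < t n by rewrite invr_gt0.
  have t1 : `|t n * (x - b)| < 1.
    rewrite normrM gtr0_norm// mulrC ltr_pdivrMr// mul1r.
    apply: (@lt_le_trans _ _ n%:R); last by rewrite ler_nat.
    by near: n; exact: nbhs_infty_gtr.
  have sp (y : R) : 0 < y < 1 -> 0 < sin y.
    by move=> /andP[y0 y1]; apply: sin2_gt0; rewrite y0 /=; lra.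
  have [xb|xb|->] := ltgtP x b.
  + rewrite [RHS]ltr0_sg ?subr_lt0// ltr0_sg// -oppr_gt0 -sinN; apply: sp.
    have ty : t n * (x - b) < 0 by rewrite pmulr_rlt0// subr_lt0.
    by rewrite oppr_gt0 ty -ltr0_norm.
  + rewrite [RHS]gtr0_sg ?subr_gt0// gtr0_sg//; apply: sp.
    have ty : 0 < t n * (x - b) by rewrite pmulr_rgt0// subr_gt0.
    by rewrite ty -(gtr0_norm ty).
  + by rewrite subrr mulr0 sin0.
- exact: same_mean_cst.
- by move=> n x; exact: normr_sg_le1.
Unshelve. all: by end_near. Qed.

(** The thresholds [- t n] increase to 0, so the limit of the signs is 1 at [x = 0]. This settles
    the value at a possible atom, where the sign of [x] itself would give one half. *)
Lemma same_mean_lt0 : same_mean (fun x => (x < 0)%R%:R).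
Proof.
pose t n : R := n.+1%:R^-1.
apply: (@same_mean_ext (fun x => 2^-1 * (1 - (1 - 2 * (x < 0)%R%:R)))).
  by move=> x; field.
apply: same_meanZ; apply: same_meanB; first exact: same_mean_cst.
apply: (@same_mean_lim (fun n x => Num.sg (x - - t n)) _ (cst 1)).
- by move=> n; exact: same_mean_sg.
- move=> x; have t0 n : 0 < t n by rewrite invr_gt0.
  have [x0|x0] := ltP x 0; last first.
    apply: cvg_near_cst; apply: nearW => n /=.
    by rewrite gtr0_sg ?mulr0 ?subr0// opprK ltr_wpDl.
  apply: cvg_near_cst; near=> n.
  rewrite ltr0_sg; first by rewrite mulr1; lra.
  have : t n < - x by near: n; apply: (cvgr_lt 0); [exact: cvg_harmonic|rewrite oppr_gt0].
  lra.
- exact: same_mean_cst.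
- by move=> n x; exact: normr_sg_le1.
Unshelve. all: by end_near. Qed.

End moment_generating_function.

(** * Moment generating function of a centered normal law *)

(** The Radon-Nikodym derivative of the normal law agrees almost everywhere with its density, both
    having the same integral over every measurable set. *)
Lemma ge0_integral_normal_prob (R : realType) (m s : R) (f : R -> \bar R) :
  (forall x, 0 <= f x)%E -> measurable_fun [set: R] f ->
  (\int[normal_prob m s]_x f x =
   \int[lebesgue_measure]_x (f x * (normal_pdf m s x)%:E))%E.
Proof.
move=> f0 mf.
have dom := normal_prob_dominates m s.
rewrite -(Radon_Nikodym_SigmaFinite.change_of_variables dom)//.
have i := Radon_Nikodym_SigmaFinite.f_integrable dom.
have mp : measurable_fun [set: R] (EFin \o normal_pdf m s).
  by apply/measurable_EFinP; exact: measurable_normal_pdf.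
apply: ae_eq_integral => //.
- by apply: emeasurable_funM => //; exact: measurable_int i.
- exact: emeasurable_funM.
- apply: ae_eqe_mul2l; apply: integral_ae_eq => //.
  by move=> E _ mE; rewrite -Radon_Nikodym_SigmaFinite.f_integral.
Qed.

(** Completing the square: [expR x] times the density of mean 0 is [expR (v / 2)] times the density
    of mean [v] and the same variance. *)
Lemma normal_prob_mgf (R : realType) (v : R) : 0 < v ->
  (\int[normal_prob 0 (Num.sqrt v)]_x (expR x)%:E = (expR (v / 2))%:E)%E.
Proof.
move=> v0; have s0 : Num.sqrt v != 0 by rewrite gt_eqF// sqrtr_gt0.
rewrite ge0_integral_normal_prob; last 2 first.
- by move=> x; rewrite lee_fin expR_ge0.
- by apply/measurable_EFinP; exact: measurable_expR.
transitivity (\int[lebesgue_measure]_x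
    ((expR (v / 2))%:E * (normal_pdf v (Num.sqrt v) x)%:E))%E.
  apply: eq_integral => x _; rewrite -!EFinM; congr EFin.
  rewrite !normal_pdfE// /normal_fun !sqr_sqrtr ?(ltW v0)//.
  rewrite mulrCA [RHS]mulrCA; congr (_ * _).
  rewrite -!expRD; congr expR; rewrite -mulr_natr; field.
  by rewrite gt_eqF.
rewrite ge0_integralZl//.
- by rewrite integral_normal_pdf mule1.
- by apply/measurable_EFinP; exact: measurable_normal_pdf.
- by move=> x _; rewrite lee_fin normal_pdf_ge0.
Qed.

Section centered_normal.
Context d (T : measurableType d) (R : realType) (P : probability T R).

Lemma ge0_integral_law_dirac (Y : T -> R) (f : R -> \bar R) :
  measurable_fun [set: T] Y -> (forall A, measurable A -> P (Y @^-1` A) = \d_(0 : R) A) ->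
  (forall x, 0 <= f x)%E -> measurable_fun [set: R] f ->
  (\int[P]_w f (Y w) = f 0%R)%E.
Proof.
move=> mY law f0 mf.
rewrite -[LHS](@ge0_integral_pushforward _ _ _ _ _ _ mY P setT f)//.
rewrite (@eq_measure_integral _ _ _ _ (dirac (0 : R))); last by move=> A mA _; exact: law.
by rewrite integral_dirac//= diracT mul1e.
Qed.

Lemma ge0_integral_law_normal (Y : T -> R) (s : R) (f : R -> \bar R) :
  measurable_fun [set: T] Y ->
  (forall A, measurable A -> P (Y @^-1` A) = normal_prob 0 s A) ->
  (forall x, 0 <= f x)%E -> measurable_fun [set: R] f ->
  (\int[P]_w f (Y w) = \int[normal_prob 0 s]_x f x)%E.
Proof.
move=> mY law f0 mf.
have mY' : measurable_fun [set: T] (Y : T -> measurableTypeR R) by exact: mY.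
rewrite -[LHS](@ge0_integral_pushforward _ _ _ _ _ _ mY' P setT f)//.
by apply: eq_measure_integral => A mA _; exact: law.
Qed.

(** For [v < 0] the square root is 0, and [normal_pdf] with deviation 0 is by convention an
    indicator vanishing on negative reals. Then neither [Y] nor [- Y] is ever negative and [Y] has
    no atom at 0, up to null sets, which exhausts the whole space. This is how the Green form gets
    its sign, without a proof of positivity from the walk. *)
Lemma centered_normal_var_ge0 (Y : T -> R) (v : R) : measurable_fun [set: T] Y ->
  centered_normal_law P Y v -> centered_normal_law P (fun w => - Y w) v -> 0 <= v.
Proof.
move=> mY lY lN; rewrite leNgt; apply/negP => v0.
have s0 : Num.sqrt v = 0 by rewrite ler0_sqrtr// ltW.
have neg (Z : T -> R) : centered_normal_law P Z v -> (P (Z @^-1` `]-oo, (0%R : R)[%classic) <= 0)%E.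
  move=> lZ; rewrite lZ// lt_eqF// s0 /normal_prob.
  rewrite le_eqVlt; apply/orP; left; apply/eqP; apply: integral0_eq => x.
  rewrite /= in_itv /= => x0; rewrite /normal_pdf eqxx indicE memNset//=.
  by rewrite in_itv /= => /andP[]; rewrite leNgt x0.
have zero : (P (Y @^-1` [set 0%R]) <= 0)%E.
  rewrite lY// lt_eqF//.
  have := normal_prob_dominates 0 (Num.sqrt v) => /null_content_dominatesP.
  by move=> -> //; exact: lebesgue_measure_set1.
have mYA A : measurable A -> measurable (Y @^-1` A).
  by move=> mA; rewrite -[X in measurable X]setTI; exact: mY.
have mN : measurable ((fun w => - Y w) @^-1` `]-oo, (0%R : R)[%classic).
  rewrite (_ : _ @^-1` _ = Y @^-1` `]0, +oo[); first exact: mYA.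
  by apply/seteqP; split => w /=; rewrite !in_itv /= oppr_lt0 andbT.
have m0 : measurable (Y @^-1` [set 0]) by exact: mYA.
have mI : measurable (Y @^-1` `]-oo, (0%R : R)[%classic) by exact: mYA.
have cover : [set: T] = Y @^-1` `]-oo, (0%R : R)[%classic `|`
    ((fun w => - Y w) @^-1` `]-oo, (0%R : R)[%classic `|` Y @^-1` [set 0]).
  apply/seteqP; split=> // w _ /=; rewrite !in_itv /= oppr_lt0.
  by have [?|?|?] := ltgtP (Y w) 0; [left|right; left|right; right].
have : (P setT <= 0)%E.
  rewrite cover; apply: (le_trans (measureU2 _ _ _)) => //; first exact: measurableU.
  rewrite -[leRHS]adde0; apply: leeD; first exact: neg.
  apply: (le_trans (measureU2 _ _ _)) => //.
  rewrite -[leRHS]adde0; apply: leeD; first exact: neg.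
  exact: zero.
by rewrite probability_setT lee_fin ler10.
Qed.

Lemma centered_normal_mgf (Y : T -> R) (v : R) : measurable_fun [set: T] Y ->
  centered_normal_law P Y v -> 0 <= v ->
  P.-integrable setT (fun w => (expR (Y w))%:E) /\
  \int[P]_w expR (Y w) = expR (v / 2).
Proof.
move=> mY lY v0.
have e : (\int[P]_w (expR (Y w))%:E = (expR (v / 2))%:E)%E.
  have [ve|vn] := eqVneq v 0.
    rewrite (@ge0_integral_law_dirac Y (fun x => (expR x)%:E))//.
    - by rewrite ve mul0r.
    - by move=> A mA; rewrite lY// ve eqxx.
    - by apply/measurable_EFinP; exact: measurable_expR.
  rewrite (@ge0_integral_law_normal Y (Num.sqrt v) (fun x => (expR x)%:E))//.
  - by rewrite normal_prob_mgf// lt_neqAle eq_sym vn.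
  - by move=> A mA; rewrite lY// (negbTE vn).
  - by apply/measurable_EFinP; exact: measurable_expR.
split; last by rewrite /Rintegral e.
apply/integrableP; split.
  by apply/measurable_EFinP; apply: measurableT_comp => //; exact: measurable_expR.
under eq_integral do rewrite gee0_abs ?lee_fin ?expR_ge0//.
by rewrite e ltry.
Qed.

End centered_normal.

(** * Cameron-Martin formula for the free field *)

(** The two cases are complementary, with the closed one for sites of the cluster, matching level
    sets of the form [h <= phi]. *)
Definition half_line {R : realType} (b : bool) (y : R) : bool :=
  if b then 0 <= y else y < 0.

Section gaussian_free_field.
Variables (R : realType) (V : countType) (nb : V -> seq V).
Hypothesis sg : simple_graph nb.
Hypothesis gc : graph_connected nb.
Hypothesis tr : transient (R := R) nb.
Context d (Omega : measurableType d) (P : probability Omega R).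
Variable phi : V -> Omega -> R.
Hypothesis gff : is_GFF nb P phi.

Lemma measurable_field x : measurable_fun [set: Omega] (phi x).
Proof. exact: gff.1. Qed.

Lemma measurable_linear (s : seq V) (a : V -> R) :
  measurable_fun [set: Omega] (fun w => \sum_(x <- s) a x * phi x w).
Proof.
apply: measurable_sum => x; apply: measurable_funM => //.
exact: measurable_field.
Qed.

Lemma gff_mgf (s : seq V) (a : V -> R) :
  P.-integrable setT (fun w => (expR (\sum_(x <- s) a x * phi x w))%:E) /\
  \int[P]_w expR (\sum_(x <- s) a x * phi x w) =
    expR ((\sum_(x <- s) \sum_(y <- s) a x * a y * green nb x y) / 2).
Proof.
have law := gff.2 s.
apply: centered_normal_mgf => //; first exact: measurable_linear.
(* Changing the sign of all coefficients leaves the quadratic form unchanged, so the field provides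
   the laws of both [Y] and [- Y] with the same [v]. *)
apply: (centered_normal_var_ge0 (measurable_linear s a) (law a)).
have := law (fun x => - a x); congr centered_normal_law.
- by apply/funext => w; rewrite -sumrN; apply: eq_bigr => x _; rewrite mulNr.
- by apply: eq_bigr => x _; apply: eq_bigr => y _; rewrite mulrNN.
Qed.

(** The equilibrium measure of [s], of total mass its capacity. *)
Definition eqm (s : seq V) (x : V) : R := deg nb x * esc nb [set` s] x.

Definition eqm_field (s : seq V) (w : Omega) : R := \sum_(x <- s) eqm s x * phi x w.

(** Density under which the field on [s] acquires the law of [phi - t]; the quadratic term
    normalises it, since [eqm_field s] has variance the capacity of [s]. *)
Definition cm_density (s : seq V) (t : R) (w : Omega) : R :=
  expR (- (t * eqm_field s w) - cap nb [set` s] * t ^+ 2 / 2).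

Lemma measurable_eqm_field s : measurable_fun [set: Omega] (eqm_field s).
Proof. exact: measurable_linear. Qed.

(** Both cross terms reduce to the sum of the [a x] because the potential of [eqm s] is 1 on [s].
    The resulting linear term is the mean produced by shifting the field by [- t], the last one the
    normalisation in [cm_density]. *)
Lemma quad_shift (s : seq V) (a : V -> R) (t : R) : uniq s ->
  \sum_(x <- s) \sum_(y <- s) (a x - t * eqm s x) * (a y - t * eqm s y) * green nb x y =
  \sum_(x <- s) \sum_(y <- s) a x * a y * green nb x y
    - 2 * t * \sum_(x <- s) a x + t ^+ 2 * cap nb [set` s].
Proof.
move=> us.
have le x : x \in s -> \sum_(y <- s) eqm s y * green nb x y = 1.
  move=> xs; rewrite -(last_exit sg gc tr us xs).
  by apply: eq_bigr => y _; rewrite mulrC.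
have cross (b : V -> R) : \sum_(x <- s) \sum_(y <- s) b x * eqm s y * green nb x y =
    \sum_(x <- s) b x.
  rewrite big_seq [RHS]big_seq; apply: eq_bigr => x xs.
  rewrite -[RHS]mulr1 -(le x xs) mulr_sumr; apply: eq_bigr => y _.
  by rewrite mulrA.
have cross' : \sum_(x <- s) \sum_(y <- s) eqm s x * a y * green nb x y =
    \sum_(x <- s) a x.
  rewrite -[RHS]cross exchange_big /=; apply: eq_bigr => x _; apply: eq_bigr => y _.
  by rewrite (green_sym sg gc tr) (mulrC (eqm _ _)).
rewrite (@cap_seqE R V nb _ us) -/(\sum_(y <- s) eqm s y) -(cross (eqm s)).
transitivity (\sum_(x <- s) \sum_(y <- s) a x * a y * green nb x y
    - t * (\sum_(x <- s) \sum_(y <- s) a x * eqm s y * green nb x y)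
    - t * (\sum_(x <- s) \sum_(y <- s) eqm s x * a y * green nb x y)
    + t ^+ 2 * (\sum_(x <- s) \sum_(y <- s) eqm s x * eqm s y * green nb x y)).
  rewrite !mulr_sumr -!sumrB -big_split /=; apply: eq_bigr => x _.
  rewrite !mulr_sumr -!sumrB -big_split /=; apply: eq_bigr => y _.
  ring.
by rewrite cross' cross; ring.
Qed.

(** Interpolation between the moment generating function and the probability of an event: sites in
    [s1] already carry half-line indicators, those in [s2] still carry exponentials. The
    coefficients [a] stay arbitrary in the induction, because moving one site to [s1] uses the
    identity for every coefficient at that site. *)
Lemma cameron_martin_partial (s : seq V) (A : V -> bool) (t : R) (s1 s2 : seq V)
    (a : V -> R) : uniq s -> perm_eq (s1 ++ s2) s ->
  let f1 w := \prod_(x <- s1) (half_line (A x) (phi x w - t))%:R *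
              expR (\sum_(x <- s2) a x * (phi x w - t)) in
  let f2 w := \prod_(x <- s1) (half_line (A x) (phi x w))%:R *
              expR (\sum_(x <- s2) a x * phi x w) * cm_density s t w in
  [/\ P.-integrable setT (EFin \o f1), P.-integrable setT (EFin \o f2) &
      \int[P]_w f1 w = \int[P]_w f2 w].
Proof.
move=> us; elim: s1 s2 a => [s2 a /= ps|x s1 IH s2 a ps].
  have E (b : V -> R) : (fun w => \sum_(x <- s2) b x * phi x w) =
      (fun w => \sum_(x <- s) b x * phi x w).
    by apply/funext => w; exact: perm_big.
  have [i1 e1] := gff_mgf s a.
  (* The linear part of the density merges with the exponential into one linear form in the
     field. *)
  have [i2 e2] := gff_mgf s (fun x => a x - t * eqm s x).
  have E1 w : \prod_(x <- [::]) (half_line (A x) (phi x w - t))%:R *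
      expR (\sum_(x <- s2) a x * (phi x w - t)) =
      expR (- t * \sum_(x <- s) a x) * expR (\sum_(x <- s) a x * phi x w).
    rewrite big_nil mul1r -expRD (perm_big _ ps) /=; congr expR.
    by rewrite mulr_sumr -big_split /=; apply: eq_bigr => x _; ring.
  have E2 w : \prod_(x <- [::]) (half_line (A x) (phi x w))%:R *
      expR (\sum_(x <- s2) a x * phi x w) * cm_density s t w =
      expR (- cap nb [set` s] * t ^+ 2 / 2) *
      expR (\sum_(x <- s) (a x - t * eqm s x) * phi x w).
    rewrite big_nil mul1r -!expRD (perm_big _ ps) /=; congr expR.
    rewrite /eqm_field [in RHS](eq_bigr (fun x => a x * phi x w + - t * (eqm s x * phi x w))).
      by rewrite big_split /= -mulr_sumr; ring.
    by move=> x _; ring.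
  split.
  - rewrite (_ : _ \o _ = fun w => ((expR (- t * \sum_(x <- s) a x))%:E *
      (expR (\sum_(x <- s) a x * phi x w))%:E)%E); first exact: integrableZl.
    by apply/funext => w; rewrite /= E1 EFinM.
  - rewrite (_ : _ \o _ = fun w => ((expR (- cap nb [set` s] * t ^+ 2 / 2))%:E *
      (expR (\sum_(x <- s) (a x - t * eqm s x) * phi x w))%:E)%E).
      exact: integrableZl.
    by apply/funext => w; rewrite /= E2 EFinM.
  - under eq_Rintegral do rewrite E1; under [RHS]eq_Rintegral do rewrite E2.
    rewrite (RintegralZl _ measurableT i1) (RintegralZl _ measurableT i2) e1 e2 -!expRD; congr expR.
    by rewrite quad_shift//; field.
have xs12 : uniq (x :: s1 ++ s2) by rewrite (perm_uniq ps).
(* The factors of all other sites act as weights, so that the one-dimensional uniqueness applies to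
   the site [x] alone. *)
pose W1 w := \prod_(x <- s1) (half_line (A x) (phi x w - t))%:R *
  expR (\sum_(x <- s2) a x * (phi x w - t)).
pose W2 w := \prod_(x <- s1) (half_line (A x) (phi x w))%:R *
  expR (\sum_(x <- s2) a x * phi x w) * cm_density s t w.
have W10 w : 0 <= W1 w.
  by rewrite mulr_ge0 ?expR_ge0//; apply: prodr_ge0 => z _; rewrite ler0n.
have W20 w : 0 <= W2 w.
  by rewrite !mulr_ge0 ?expR_ge0//; apply: prodr_ge0 => z _; rewrite ler0n.
have same b : same_mean P W1 W2 (fun w => phi x w - t) (phi x) (fun y => expR (b * y)).
  have ps' : perm_eq (s1 ++ x :: s2) s.
    by rewrite (perm_trans _ ps)//= -cat1s perm_catCA.
  (* Overriding the coefficient at [x] leaves the sum over [s2] unchanged since, by uniqueness of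
     the sites, [x] is not in [s2]. *)
  pose a' z := if z == x then b else a z.
  have F (y : V -> R) : \sum_(z <- x :: s2) a' z * y z = b * y x + \sum_(z <- s2) a z * y z.
    rewrite big_cons /a' eqxx; congr (_ + _).
    rewrite big_seq [RHS]big_seq; apply: eq_bigr => z zs; case: eqP => // zx.
    by move: xs12; rewrite /= mem_cat -zx zs orbT.
  have [] := IH (x :: s2) a' ps'; rewrite /comp.
  under eq_fun do rewrite (F (fun z => phi z _ - t)) expRD mulrCA mulrC.
  move=> i1.
  under eq_fun do rewrite (F (phi ^~ _)) expRD [_ * (_ * _)]mulrCA -mulrA mulrC.
  move=> i2.
  under eq_Rintegral do rewrite (F (fun z => phi z _ - t)) expRD mulrCA mulrC.
  under [RHS]eq_Rintegral do rewrite (F (phi ^~ _)) expRD [_ * (_ * _)]mulrCA -mulrA mulrC.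
  by move=> e.
have lt0 := same_mean_lt0 W10 W20 same.
have all1 := same_mean_cst same 1.
have hl : same_mean P W1 W2 (fun w => phi x w - t) (phi x)
    (fun y => (half_line (A x) y)%:R).
  rewrite /half_line; case: (A x) => //.
  apply: same_mean_ext (same_meanB all1 lt0) => y.
  by rewrite leNgt; case: (y < 0); rewrite /= ?subrr ?subr0.
move: hl => [i1 i2 e].
split.
- rewrite (_ : _ \o _ = fun w => (W1 w * (half_line (A x) (phi x w - t))%:R)%:E)//.
  by apply/funext => w; rewrite /= big_cons /W1; congr EFin; ring.
- rewrite (_ : _ \o _ = fun w => (W2 w * (half_line (A x) (phi x w))%:R)%:E)//.
  by apply/funext => w; rewrite /= big_cons /W2; congr EFin; ring.
- transitivity (\int[P]_w (W1 w * (half_line (A x) (phi x w - t))%:R)).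
    by apply: eq_Rintegral => w _; rewrite big_cons /W1; ring.
  rewrite e; apply: eq_Rintegral => w _.
  by rewrite big_cons /W2; ring.
Qed.

Lemma cameron_martin (s : seq V) (A : V -> bool) (t : R) : uniq s ->
  \int[P]_w (\prod_(x <- s) (half_line (A x) (phi x w - t))%:R) =
  \int[P]_w (\prod_(x <- s) (half_line (A x) (phi x w))%:R * cm_density s t w).
Proof.
move=> us; have ps : perm_eq (s ++ [::]) s by rewrite cats0.
have [_ _] := cameron_martin_partial A t (fun=> 0) us ps.
under eq_Rintegral do rewrite big_nil expR0 mulr1.
by under [X in _ = X -> _]eq_Rintegral do rewrite big_nil expR0 mulr1.
Qed.

End gaussian_free_field.

(** * Derivatives of Gaussian Laplace transforms *)

(** Crude domination, uniform for [x] in a bounded interval, serving differentiation under the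
    integral. The power costs a factorial and one more unit in the exponential of [|m|]. *)
Lemma gaussian_kernel_bound (R : realType) (c a m x : R) k : 0 <= c -> `|x| <= a ->
  `|(m + c * x) ^+ k * expR (- (x * m) - c * x ^+ 2 / 2)| <=
  k`!%:R * expR (c * a) * (expR ((a + 1) * m) + expR (- (a + 1) * m)).
Proof.
move=> c0 xa; have a0 : 0 <= a by apply: le_trans xa.
rewrite normrM normrX [ `|expR _|]ger0_norm ?expR_ge0//.
have h1 : `|m + c * x| <= `|m| + c * a.
  by apply: (le_trans (ler_normD _ _)); rewrite lerD2l normrM ger0_norm// ler_wpM2l.
have h0 : 0 <= `|m| + c * a by rewrite addr_ge0// mulr_ge0.
have h2 : `|m + c * x| ^+ k <= k`!%:R * expR (`|m| + c * a).
  by apply: le_trans (exprn_le_fact_expR k h0); rewrite lerXn2r ?nnegrE.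
have h3 : expR (- (x * m) - c * x ^+ 2 / 2) <= expR (a * `|m|).
  rewrite ler_expR; apply: (@le_trans _ _ `|x * m|).
    apply: (@le_trans _ _ (- (x * m))); last by rewrite -normrN ler_norm.
    by rewrite gerBl mulr_ge0// mulr_ge0// sqr_ge0.
  by rewrite normrM ler_wpM2r.
apply: (@le_trans _ _ (k`!%:R * expR (`|m| + c * a) * expR (a * `|m|))).
  by apply: ler_pM => //; rewrite ?exprn_ge0 ?expR_ge0.
rewrite -!mulrA ler_wpM2l// mulNr.
apply: (@le_trans _ _ (expR (c * a) * expR `|(a + 1) * m|)).
  rewrite -!expRD ler_expR normrM ger0_norm ?addr_ge0//.
  by rewrite le_eqVlt; apply/orP; left; apply/eqP; ring.
by rewrite ler_wpM2l ?expR_ge0//; exact: expR_norm_le.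
Qed.

(* [expR (2 * r * `|m + c * u|)] absorbs the power and the move from [u] to [x], and
   is itself dominated by the kernels at [u - 2 r] and [u + 2 r]. *)
Lemma gaussian_kernel_shift (R : realType) (c r u m x : R) k :
  0 <= c -> 0 < r -> c * r ^+ 2 <= 1 -> `|x - u| <= r ->
  `|(m + c * x) ^+ k * expR (- (x * m) - c * x ^+ 2 / 2)| <=
  k`!%:R * expR 3 * r^-1 ^+ k *
    (expR (- ((u + 2 * r) * m) - c * (u + 2 * r) ^+ 2 / 2) +
     expR (- ((u - 2 * r) * m) - c * (u - 2 * r) ^+ 2 / 2)).
Proof.
move=> c0 r0 cr xu; set N := m + c * u; set s := x - u.
pose y := r * `|N|; have y0 : 0 <= y by rewrite mulr_ge0// ltW.
rewrite normrM normrX [ `|expR _|]ger0_norm ?expR_ge0//.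
have -> : m + c * x = N + c * s by rewrite /N /s; ring.
have -> : - (x * m) - c * x ^+ 2 / 2 =
    (- (u * m) - c * u ^+ 2 / 2) + (- (s * N) - c * s ^+ 2 / 2).
  by rewrite /N /s; field.
(* Expanding around [u] factors the kernel at [u + e] into the kernel at [u] and a kernel in [e]
   with [m] replaced by [N]. *)
have E (e : R) : - ((u + e) * m) - c * (u + e) ^+ 2 / 2 =
    (- (u * m) - c * u ^+ 2 / 2) + (- (e * N) - c * e ^+ 2 / 2).
  by rewrite /N; field.
rewrite !E; set q := - (u * m) - c * u ^+ 2 / 2.
rewrite !(expRD q) -mulrDr; set Eu := expR q.
have Eu0 : 0 <= Eu by exact: expR_ge0.
have h1 : `|N + c * s| <= r^-1 * (y + 1).
  rewrite [leRHS]mulrDr mulr1 /y mulKf ?gt_eqF//; apply: (le_trans (ler_normD _ _)).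
  rewrite lerD2l normrM ger0_norm//; apply: (@le_trans _ _ (c * r)).
    by rewrite ler_wpM2l.
  by rewrite -[leRHS]mulr1 ler_pdivlMl// mulrCA -expr2.
have h2 : `|N + c * s| ^+ k <= r^-1 ^+ k * (k`!%:R * expR (y + 1)).
  have y1 : 0 <= y + 1 by rewrite addr_ge0.
  apply: (@le_trans _ _ ((r^-1 * (y + 1)) ^+ k)).
    by rewrite lerXn2r ?nnegrE// (le_trans _ h1).
  rewrite exprMn ler_wpM2l ?exprn_ge0 ?invr_ge0 ?(ltW r0)//.
  exact: exprn_le_fact_expR.
have h3 : expR (- (s * N) - c * s ^+ 2 / 2) <= expR y.
  rewrite ler_expR; apply: (@le_trans _ _ `|s * N|).
    apply: (@le_trans _ _ (- (s * N))); last by rewrite -normrN ler_norm.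
    by rewrite gerBl mulr_ge0// mulr_ge0// sqr_ge0.
  by rewrite normrM ler_wpM2r.
(* The loss [c * (2 * r) ^+ 2 / 2] equals [2 * (c * r ^+ 2)], at most 2. Together with the 1 spent
   in [h2] this is the origin of [expR 3]. *)
have h4 : expR (2 * y) <= expR 2 *
    (expR (- (2 * r * N) - c * (2 * r) ^+ 2 / 2) +
     expR (- (- (2 * r) * N) - c * (- (2 * r)) ^+ 2 / 2)).
  have -> : 2 * y = `|2 * r * N|.
    by rewrite !normrM (ger0_norm (ler0n _ _)) (gtr0_norm r0) /y mulrA.
  apply: (le_trans (expR_norm_le _)).
  rewrite [leRHS]mulrDr -!expRD addrC sqrrN.
  have crr : c * (2 * r) ^+ 2 / 2 = 2 * (c * r ^+ 2) by field.
  rewrite crr; apply: lerD; rewrite ler_expR; lra.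
apply: (@le_trans _ _ ((r^-1 ^+ k * (k`!%:R * expR (y + 1))) * (Eu * expR y))).
  apply: ler_pM => //; rewrite ?exprn_ge0 ?mulr_ge0 ?expR_ge0//.
  by rewrite ler_wpM2l.
have -> : r^-1 ^+ k * (k`!%:R * expR (y + 1)) * (Eu * expR y) =
    k`!%:R * expR 1 * r^-1 ^+ k * (Eu * expR (2 * y)).
  have -> : expR (2 * y) = expR y * expR y by rewrite -expRD; congr expR; ring.
  by rewrite expRD; ring.
have -> : expR 3 = expR 1 * expR 2 :> R by rewrite -expRD; congr expR; ring.
set X := (_ + _ in X in _ <= X) in h4 *.
have -> : k`!%:R * (expR 1 * expR 2) * r^-1 ^+ k * (Eu * X) =
   k`!%:R * expR 1 * r^-1 ^+ k * (Eu * (expR 2 * X)) by ring.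
apply: ler_wpM2l; first by rewrite !mulr_ge0 ?exprn_ge0 ?invr_ge0 ?expR_ge0 ?ltW.
by rewrite ler_wpM2l.
Qed.

(** The exponent has derivative [- (m + c * t)], so a derivative lowers or raises the power by one,
    as for Hermite polynomials. At [j = 0] the truncated [j.-1] is harmless, its coefficient being
    0. *)
Lemma is_derive_gaussian_kernel (R : realType) (m c t : R) j :
  is_derive t 1 (fun t => (m + c * t) ^+ j * expR (- (t * m) - c * t ^+ 2 / 2))
   (c * j%:R * ((m + c * t) ^+ j.-1 * expR (- (t * m) - c * t ^+ 2 / 2)) -
    (m + c * t) ^+ j.+1 * expR (- (t * m) - c * t ^+ 2 / 2)).
Proof.
have h0 : is_derive t 1 (fun t : R => m + c * t) c.
  by apply: is_derive_eq; rewrite /GRing.scale /=; ring.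
have h1 := is_deriveX j h0.
have h2 : is_derive t 1 (fun t : R => - (t * m) - c * t ^+ 2 / 2) (- (m + c * t)).
  by apply: is_derive_eq; rewrite !scaler0 /GRing.scale /=; field.
have h3 := is_derive1_comp (is_derive_expR _) h2.
have h4 := is_deriveM h1 h3.
set f := (X in is_derive _ _ X _).
have <- : (fun t : R => m + c * t) ^+ j * (expR \o (fun t : R => - (t * m) - c * t ^+ 2 / 2)) = f.
  by apply/funext => x; rewrite /f /GRing.mul /= exprfctE.
apply: is_derive_eq.
rewrite /= exprfctE /GRing.scale /= [(m + c * t) ^+ j.+1]exprS.
by set E := expR _; clearbody E; ring.
Qed.
Section gaussian_laplace.
Context d (T : measurableType d) (R : realType) (P : {measure set T -> \bar R}).
Variables (W M : T -> R) (c : R).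
Hypothesis W0 : forall w, 0 <= W w.
Hypothesis mW : measurable_fun [set: T] W.
Hypothesis mM : measurable_fun [set: T] M.
Hypothesis c0 : 0 <= c.
Hypothesis iW : forall a, P.-integrable setT (fun w => (W w * expR (a * M w))%:E).

(** For [j = 0] the integral is a Laplace transform of [M] under the weight [W], times a Gaussian
    factor in [t]; larger [j] insert the powers created by differentiation. *)
Definition glap_integrand j t w : R :=
  W w * ((M w + c * t) ^+ j * expR (- (t * M w) - c * t ^+ 2 / 2)).

Definition glap j t : R := \int[P]_w glap_integrand j t w.

Definition glap_dominant (K a : R) w : R :=
  K * (W w * (expR (a * M w) + expR (- a * M w))).

Lemma integrable_glap_dominant K a :
  P.-integrable setT (fun w => (glap_dominant K a w)%:E).
Proof.
under eq_fun do rewrite /glap_dominant EFinM mulrDr EFinD.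
by apply: integrableZl => //; exact: integrableD.
Qed.

Lemma glap_dominated (a : R) j (t : R) w : `|t| <= a ->
  `|glap_integrand j t w| <= glap_dominant (j`!%:R * expR (c * a)) (a + 1) w.
Proof.
move=> ta; rewrite /glap_integrand /glap_dominant normrM ger0_norm// [leRHS]mulrCA.
by apply: ler_wpM2l => //; exact: gaussian_kernel_bound.
Qed.

Lemma measurable_glap_integrand j t : measurable_fun [set: T] (glap_integrand j t).
Proof.
apply: measurable_funM => //; apply: measurable_funM.
  by apply: measurable_funX; exact: measurable_funD.
apply: (measurableT_comp (@measurable_expR R)).
apply: measurable_funB => //; apply: measurableT_comp => //.
exact: measurable_funM.
Qed.

Lemma integrable_glap_integrand j t :
  P.-integrable setT (EFin \o glap_integrand j t).
Proof.
apply: le_integrable (integrable_glap_dominant (j`!%:R * expR (c * `|t|)) (`|t| + 1)) => //.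
  by apply/measurable_EFinP; exact: measurable_glap_integrand.
move=> w _; rewrite /= lee_fin; apply: (le_trans (glap_dominated _ _ (lexx _))).
exact: ler_norm.
Qed.

Lemma is_derive_glap_integrand j (t : R) w :
  is_derive t 1 (glap_integrand j ^~ w)
    (c * j%:R * glap_integrand j.-1 t w - glap_integrand j.+1 t w).
Proof.
rewrite /glap_integrand.
have h := is_derive_gaussian_kernel (M w) c t j.
have hZ := is_deriveZ (W w) h.
rewrite (mulrCA (c * _)) -mulrBr; exact: hZ.
Qed.

Lemma is_derive_glap j (t : R) :
  is_derive t 1 (glap j) (c * j%:R * glap j.-1 t - glap j.+1 t).
Proof.
(* [a] bounds [|x|] on the interval of radius 1 around [t], where one dominating function must serve
   for all [x]. *)
pose a := `|t| + 1.
pose G w := c * j%:R * glap_dominant (j.-1`!%:R * expR (c * a)) (a + 1) w +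
  glap_dominant (j.+1`!%:R * expR (c * a)) (a + 1) w.
have gd0 K b w : 0 <= K -> 0 <= glap_dominant K b w.
  by move=> K0; rewrite !mulr_ge0// addr_ge0// expR_ge0.
have Ia x : x \in `]t - 1, t + 1[ -> `|x| <= a.
  rewrite in_itv /= => /andP[x1 x2]; rewrite /a.
  have tl : t <= `|t| by exact: ler_norm.
  have tg : - `|t| <= t by have := ler_norm (- t); rewrite normrN; lra.
  by rewrite ler_norml; apply/andP; split; lra.
have tI : t \in `]t - 1, t + 1[ by rewrite in_itv /=; apply/andP; split; lra.
have dE x w : partial1of2 (glap_integrand j) x w =
    c * j%:R * glap_integrand j.-1 x w - glap_integrand j.+1 x w.
  by rewrite partial1of2E; apply: derive_val; exact: is_derive_glap_integrand.
have iG : P.-integrable setT (EFin \o G).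
  rewrite /comp /G; under eq_fun do rewrite EFinD EFinM.
  apply: integrableD => //; last exact: integrable_glap_dominant.
  by apply: integrableZl => //; exact: integrable_glap_dominant.
have G0 w : 0 <= G w.
  by rewrite addr_ge0 ?mulr_ge0// gd0// mulr_ge0 ?expR_ge0.
have Gub x w : `]t - 1, t + 1[%classic x -> [set: T] w ->
    `|partial1of2 (glap_integrand j) x w| <= G w.
  move=> /Ia xa _; rewrite dE; apply: (le_trans (ler_normB _ _)); apply: lerD.
    rewrite normrM ger0_norm ?mulr_ge0// ler_wpM2l ?mulr_ge0//.
    exact: glap_dominated.
  exact: glap_dominated.
have df x w : `]t - 1, t + 1[%classic x -> [set: T] w ->
    derivable (glap_integrand j ^~ w) x 1.
  by move=> _ _; have [] := is_derive_glap_integrand j x w.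
have intf x : `]t - 1, t + 1[%classic x ->
    P.-integrable setT (EFin \o glap_integrand j x).
  by move=> _; exact: integrable_glap_integrand.
apply: DeriveDef.
  exact: (@derivable_under_integral R _ T P (glap_integrand j) setT measurableT
    t _ _ tI intf df G G0 iG Gub).
rewrite -derive1E.
rewrite (@differentiation_under_integral R _ T P (glap_integrand j) setT measurableT
  t _ _ tI intf df G G0 iG Gub).
under eq_Rintegral do rewrite dE.
rewrite RintegralB//; last first.
- exact: integrable_glap_integrand.
- rewrite /comp; under eq_fun do rewrite EFinM; apply: integrableZl => //.
  exact: integrable_glap_integrand.
by rewrite RintegralZl//; exact: integrable_glap_integrand.
Qed.

(** The [k]-th derivative of [glap j], given by recursion rather than by a derivation operator so
    that bounds follow by induction on [k] alone. *)
Fixpoint glap_deriv k j t : R :=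
  if k is k'.+1 then c * j%:R * glap_deriv k' j.-1 t - glap_deriv k' j.+1 t
  else glap j t.

Lemma is_derive_glap_deriv k j (t : R) :
  is_derive t 1 (glap_deriv k j) (glap_deriv k.+1 j t).
Proof.
elim: k j t => [|k IH] j t; first exact: is_derive_glap.
have h1 := IH j.-1 t; have h2 := IH j.+1 t.
have h3 : is_derive t 1 (fun t => c * j%:R * glap_deriv k j.-1 t)
    (c * j%:R * glap_deriv k.+1 j.-1 t) by exact: is_deriveZ.
exact: is_deriveB.
Qed.

Lemma glap_ge0 t : 0 <= glap 0 t.
Proof. by apply: Rintegral_ge0 => w _; rewrite !mulr_ge0 ?expR_ge0. Qed.

Lemma glap_shift j t u r : 0 < r -> c * r ^+ 2 <= 1 -> `|t - u| <= r ->
  `|glap j t| <= j`!%:R * expR 3 * r^-1 ^+ j * (glap 0 (u + 2 * r) + glap 0 (u - 2 * r)).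
Proof.
move=> r0 cr tu.
have i0 x := integrable_glap_integrand 0 x.
apply: (le_trans (le_normr_Rintegral _ _)) => //; first exact: integrable_glap_integrand.
rewrite /glap -RintegralD//.
have iD : P.-integrable setT (EFin \o
    (fun w => glap_integrand 0 (u + 2 * r) w + glap_integrand 0 (u - 2 * r) w)).
  by rewrite /comp; under eq_fun do rewrite EFinD; apply: integrableD => //; exact: i0.
rewrite -RintegralZl//; apply: le_Rintegral => //.
- exact: (integrable_norm (integrable_glap_integrand j t)).
- by rewrite /comp; under eq_fun do rewrite EFinM; apply: integrableZl.
- move=> w _; rewrite /glap_integrand !expr0 !mul1r -mulrDr [leRHS]mulrCA normrM ger0_norm//.
  by apply: ler_wpM2l => //; exact: gaussian_kernel_shift.
Qed.

End gaussian_laplace.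

(** Same recursion as [glap_deriv] with signs and [c] removed, started at the constant of
    [glap_shift]. *)
Fixpoint glap_const {R : realType} k j : R :=
  if k is k'.+1 then j%:R * glap_const k' j.-1 + glap_const k' j.+1
  else j`!%:R * expR 3.

Lemma glap_const_ge0 (R : realType) k j : 0 <= glap_const k j :> R.
Proof.
elim: k j => [|k IH] j /=; first by rewrite mulr_ge0 ?expR_ge0.
by rewrite addr_ge0 ?mulr_ge0.
Qed.

(** Every derivative costs one factor [r^-1]. Raising the power pays for it directly; lowering the
    power leaves two factors [r^-1] to spare, and these absorb [c], since [c <= r^-1 ^+ 2]. *)
Lemma glap_deriv_shift d (T : measurableType d) (R : realType)
    (P : {measure set T -> \bar R}) (W M : T -> R) (c : R) k j t u r :
  (forall w, 0 <= W w) -> measurable_fun [set: T] W -> measurable_fun [set: T] M ->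
  0 <= c -> (forall a, P.-integrable setT (fun w => (W w * expR (a * M w))%:E)) ->
  0 < r -> c * r ^+ 2 <= 1 -> `|t - u| <= r ->
  `|glap_deriv P W M c k j t| <= glap_const k j * r^-1 ^+ (j + k) *
    (glap P W M c 0 (u + 2 * r) + glap P W M c 0 (u - 2 * r)).
Proof.
move=> W0 mW mM c0 iW r0 cr tu.
set B := glap _ _ _ _ _ _ + _.
have B0 : 0 <= B by rewrite addr_ge0// glap_ge0.
have R0 : 0 <= r^-1 by rewrite invr_ge0 ltW.
elim: k j => [|k IH] j; first by rewrite addn0; exact: glap_shift.
rewrite /=; apply: (le_trans (ler_normB _ _)).
rewrite mulrDl mulrDl; apply: lerD; last by rewrite addnS -addSn; exact: IH.
case: j => [|j]; first by rewrite mulr0 !mul0r normr0.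
rewrite /= normrM ger0_norm ?mulr_ge0//.
apply: (@le_trans _ _ (c * j.+1%:R * (glap_const k j * r^-1 ^+ (j + k) * B))).
  by rewrite ler_wpM2l ?mulr_ge0.
have -> : c * j.+1%:R * (glap_const k j * r^-1 ^+ (j + k) * B) =
    c * (j.+1%:R * glap_const k j * r^-1 ^+ (j + k) * B) by ring.
have -> : j.+1%:R * glap_const k j * r^-1 ^+ (j.+1 + k.+1) * B =
    r^-1 ^+ 2 * (j.+1%:R * glap_const k j * r^-1 ^+ (j + k) * B).
  by rewrite addnS addSn !exprS; ring.
apply: ler_wpM2r; first by rewrite !mulr_ge0 ?exprn_ge0 ?glap_const_ge0.
by rewrite exprVn -[leRHS]mul1r ler_pdivlMr ?exprn_gt0.
Qed.

(** * Finite clusters *)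

Section cluster_events.
Variables (R : realType) (V : countType) (nb : V -> seq V).
Hypothesis sg : simple_graph nb.
Hypothesis gc : graph_connected nb.
Hypothesis tr : transient (R := R) nb.
Context d (Omega : measurableType d) (P : probability Omega R).
Variable phi : V -> Omega -> R.
Hypothesis gff : is_GFF nb P phi.
Variable X : {fset V}.
Local Notation clus h w := (Defs.cluster nb phi h [set` X] w).

(* The sites whose field values decide whether the cluster of [X] equals [S]. *)
Definition witness (S : {fset V}) : seq V :=
  undup (enum_fset S ++ enum_fset X ++ flatten [seq nb x | x <- enum_fset S]).

Lemma witness_uniq S : uniq (witness S). Proof. exact: undup_uniq. Qed.

Lemma mem_witness S x : x \in witness S =
  [|| x \in S, x \in X | has (fun y => x \in nb y) (enum_fset S)].
Proof.
rewrite mem_undup !mem_cat; congr [|| _, _ | _].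
by apply/flatten_mapP/hasP => -[y]; exists y.
Qed.

Lemma witness_setE S : [set` witness S] = closure_nb nb [set` S] `|` [set` X].
Proof.
apply/seteqP; split => x /=; rewrite mem_witness.
  move=> /or3P[xS|xX|/hasP[y yS xy]]; [by left; left|by right|].
  by left; right; exists y.
by move=> [[xS|[y [yS xy]]]|xX]; apply/or3P;
  [constructor 1|constructor 3; apply/hasP; exists y|constructor 2].
Qed.

(** The part of the cluster event that does not depend on the field. Sites of [X] outside [S] are
    allowed: they are those below the height. *)
Definition reachable (S : {fset V}) : Prop :=
  forall y, y \in S -> exists x (p : seq V), x \in X /\ path (adj nb) x p /\
    last x p = y /\ all (fun v => v \in S) (x :: p).

(** Conversely to the evident constraints, a path at or above the height starting in [X] cannot
    leave [S]: its start and every neighbour of [S] are in [witness S], and those outside [S] are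
    strictly below. The event thus becomes a product of conditions on single sites. *)
Lemma clusterP h w (S : {fset V}) : clus h w = [set` S] <->
  reachable S /\ all (fun x => half_line (x \in S) (phi x w - h)) (witness S).
Proof.
split=> [CS|[rS /allP hl]].
  have inC y : y \in S -> exists x (p : seq V), [set` X] x /\ path (adj nb) x p /\
      last x p = y /\ all (fun v => h <= phi v w) (x :: p).
    by move=> yS; have : [set` S] y by []; rewrite -CS.
  have Cin y : clus h w y -> y \in S by rewrite CS.
  split.
    move=> y /inC[x [p [Xx [xp [py ph]]]]]; exists x, p; split => //; split => //; split => //.
    apply/allP => z; rewrite inE => zp; apply: Cin.
    move: zp; case/predU1P => [->|zp].
      by exists x, [::]; split => //; split => //; split => //=; move: ph => /= /andP[->].
    move: xp ph py; case/splitPr: zp => p1 p2.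
    (* Cutting the path at [z] shows that [z] itself belongs to the cluster. *)
    rewrite -cat_rcons cat_path => /andP[xp1 _] /=.
    rewrite all_cat => /andP[xh /andP[ph1 _]] _.
    by exists x, (rcons p1 z); split => //; split => //; rewrite last_rcons /= xh ph1.
  apply/allP => x; rewrite mem_witness /half_line; case: ifPn => [xS _|xS].
    have [x0 [p [_ [_ [<- /allP ph]]]]] := inC _ xS.
    by rewrite subr_ge0; apply: ph; exact: mem_last.
  move=> /orP[//|xh]; rewrite subr_lt0 ltNge; apply/negP => hx.
  move/negP: xS; apply; apply: Cin; case/orP: xh => [xX|/hasP[y yS xy]].
    by exists x, [::]; rewrite /= hx.
  have [x0 [p [Xx0 [x0p [py ph]]]]] := inC _ yS.
  exists x0, (rcons p x); split => //; split.
    by rewrite rcons_path x0p py.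
  by rewrite last_rcons /= all_rcons hx; split => //; move: ph => /= /andP[-> ->].
have hS x : x \in S -> h <= phi x w.
  by move=> xS; have := hl x; rewrite mem_witness xS /= subr_ge0; exact.
have hB x : x \in witness S -> h <= phi x w -> x \in S.
  move=> /hl; rewrite /half_line; case: ifPn => // _.
  by rewrite subr_lt0 ltNge => /negP.
apply/seteqP; split => y /=.
  move=> [x [p [Xx [xp [<- ph]]]]] {y}.
  have xS : x \in S.
    by apply: hB; [rewrite mem_witness Xx orbT|move: ph => /= /andP[]].
  elim: p x xS {Xx} xp ph => [//|z p IH] x xS /= /andP[xz zp] /and3P[xh zh ph].
  apply: IH => //; last by rewrite /= zh.
  apply: hB => //; rewrite mem_witness; apply/or3P; constructor 3.
  by apply/hasP; exists x.
move=> /rS[x [p [xX [xp [py /allP pS]]]]].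
by exists x, p; split => //; split => //; split => //; apply/allP => z /pS /hS.
Qed.

(* [fset0] is a junk value at the indices that code no finite set; they are
   excluded by [valid_index]. *)
Definition nth_fset (i : nat) : {fset V} := odflt fset0%fset (pickle_inv i).

Definition valid_index (i : nat) : bool := isSome (pickle_inv i : option {fset V}).

Definition cluster_event (i : nat) (h : R) : set Omega :=
  [set w | valid_index i /\ clus h w = [set` nth_fset i]].

Definition event_weight (i : nat) (w : Omega) : R :=
  (valid_index i && `[< reachable (nth_fset i) >])%:R *
  \prod_(x <- witness (nth_fset i)) (half_line (x \in nth_fset i) (phi x w))%:R.

Definition event_capacity (i : nat) : R := cap nb [set` witness (nth_fset i)].

Definition event_field (i : nat) : Omega -> R :=
  eqm_field nb phi (witness (nth_fset i)).

Lemma prod_boolE (I : Type) (s : seq I) (p : I -> bool) :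
  \prod_(x <- s) (p x)%:R = (all p s)%:R :> R.
Proof.
elim: s => [|x s IH]; first by rewrite big_nil.
by rewrite big_cons IH /=; case: (p x); rewrite ?mul1r ?mul0r.
Qed.

Lemma cluster_eventE i h w : \1_(cluster_event i h) w =
  (valid_index i && `[< reachable (nth_fset i) >])%:R *
  \prod_(x <- witness (nth_fset i)) (half_line (x \in nth_fset i) (phi x w - h))%:R :> R.
Proof.
rewrite prod_boolE -natrM mulnb indicE; congr (nat_of_bool _)%:R.
apply/idP/idP; rewrite inE.
  by move=> [-> /clusterP[/asboolP -> ->]].
by move=> /andP[/andP[vi /asboolP ri] hl]; split => //; apply/clusterP.
Qed.

Lemma measurable_half_line b (Y : Omega -> R) : measurable_fun [set: Omega] Y ->
  measurable_fun [set: Omega] (fun w => (half_line b (Y w))%:R : R).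
Proof.
move=> mY; pose A : set R := if b then `[0, +oo[%classic else `]-oo, 0[%classic.
have mA : measurable A by rewrite /A; case: (b).
rewrite (_ : (fun _ => _) = \1_A \o Y); first exact: measurableT_comp.
apply/funext => w; rewrite /= indicE /A /half_line; congr (nat_of_bool _)%:R.
by case: (b); apply/idP/idP; rewrite inE /= in_itv /= ?andbT.
Qed.

Lemma measurable_prod_half_line s (A : V -> bool) h :
  measurable_fun [set: Omega] (fun w => \prod_(x <- s) (half_line (A x) (phi x w - h))%:R : R).
Proof.
apply: measurable_prod => x _; apply: measurable_half_line.
by apply: measurable_funB => //; exact: (measurable_field gff).
Qed.

Lemma measurable_cluster_event i h : measurable (cluster_event i h).
Proof.
rewrite (_ : cluster_event i h = (\1_(cluster_event i h) : _ -> R) @^-1` [set 1]).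
  have mf : measurable_fun [set: Omega] (\1_(cluster_event i h) : _ -> R).
    rewrite (funext (cluster_eventE i h)); apply: measurable_funM => //.
    exact: measurable_prod_half_line.
  by rewrite -[X in measurable X]setTI; exact: mf.
apply/seteqP; split => w /=; rewrite indicE; first by move=> ?; rewrite mem_set.
by case: (boolP (w \in _)) => [/[!inE]//|_ /eqP]; rewrite eq_sym oner_eq0.
Qed.

Lemma event_weight_ge0 i w : 0 <= event_weight i w.
Proof. by rewrite mulr_ge0//; apply: prodr_ge0 => x _; rewrite ler0n. Qed.

Lemma measurable_event_weight i : measurable_fun [set: Omega] (event_weight i).
Proof.
apply: measurable_funM => //.
apply: eq_measurable_fun (measurable_prod_half_line (witness (nth_fset i))
  (fun x => x \in nth_fset i) 0) => w _.
by apply: eq_bigr => x _; rewrite subr0.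
Qed.

Lemma measurable_event_field i : measurable_fun [set: Omega] (event_field i).
Proof. exact: (measurable_eqm_field gff). Qed.

Lemma event_capacity_ge0 i : 0 <= event_capacity i.
Proof. exact: (cap_ge0 tr). Qed.

Lemma integrable_event_weight i a :
  P.-integrable setT (fun w => (event_weight i w * expR (a * event_field i w))%:E).
Proof.
have [ie _] := gff_mgf gff (witness (nth_fset i))
  (fun x => a * @eqm R V nb (witness (nth_fset i)) x).
apply: le_integrable ie => //.
  apply/measurable_EFinP; apply: measurable_funM; first exact: measurable_event_weight.
  apply: (measurableT_comp (@measurable_expR R)); apply: measurable_funM => //.
  exact: measurable_event_field.
move=> w _; rewrite /= lee_fin (ger0_norm (expR_ge0 _)).
rewrite (ger0_norm (mulr_ge0 (event_weight_ge0 i w) (expR_ge0 _))).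
have -> : \sum_(x <- witness (nth_fset i)) a * @eqm R V nb (witness (nth_fset i)) x * phi x w =
    a * event_field i w.
  by rewrite /event_field /eqm_field mulr_sumr; apply: eq_bigr => x _; rewrite mulrA.
apply: ler_piMl; first exact: expR_ge0.
rewrite /event_weight prod_boolE -natrM mulnb.
by rewrite (ler_nat _ _ 1); case: (_ && _).
Qed.

(** The cluster event at height [h] is the event at height 0 for the field [phi - h]; the shift
    formula turns its probability into a transform in which [h] appears only as the parameter. *)
Lemma cluster_event_prob i h : P (cluster_event i h) =
  (glap P (event_weight i) (event_field i) (event_capacity i) 0 h)%:E.
Proof.
have fE : P (cluster_event i h) = (fine (P (cluster_event i h)))%:E.
  by rewrite fineK// fin_num_measure//; exact: measurable_cluster_event.
rewrite fE; congr EFin.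
have -> : fine (P (cluster_event i h)) = \int[P]_w \1_(cluster_event i h) w.
  rewrite /Rintegral integral_indic ?setIT//; exact: measurable_cluster_event.
under eq_Rintegral do rewrite cluster_eventE.
pose s := witness (nth_fset i); pose A x := x \in nth_fset i.
have us : uniq s := witness_uniq _.
have ps : perm_eq (s ++ [::]) s by rewrite cats0.
(* With no exponential factor left, the partial formula supplies the integrability of both
   products. *)
have [i1 i2 e] := cameron_martin_partial sg gc tr gff A h (fun=> 0) us ps.
rewrite RintegralZl//; last first.
  by apply: eq_integrable i1 => // w _; rewrite /= big_nil expR0 mulr1.
rewrite (cameron_martin sg gc tr gff A h us).
rewrite -RintegralZl//; last first.
  by apply: eq_integrable i2 => // w _; rewrite /= big_nil expR0 mulr1.
apply: eq_Rintegral => w _.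
by rewrite /glap_integrand expr0 mul1r mulrA.
Qed.

Lemma nth_fset_surj (S : {fset V}) : exists2 i, valid_index i & nth_fset i = S.
Proof.
by exists (choice.pickle S);
  rewrite /valid_index /nth_fset pickleK_inv.
Qed.

Lemma nth_fset_inj i j : valid_index i -> valid_index j ->
  [set` nth_fset i] = [set` nth_fset j] -> i = j.
Proof.
move=> vi vj /seteqP[ij ji].
have : nth_fset i = nth_fset j by apply/fsetP => x; apply/idP/idP; [exact: ij|exact: ji].
move: vi vj; rewrite /valid_index /nth_fset.
have := pickle_invK (T := {fset V}) i; have := pickle_invK (T := {fset V}) j.
case: (pickle_inv i) => [S|]//; case: (pickle_inv j) => [S'|]//=.
by move=> <- <- _ _ ->.
Qed.

Lemma trivIset_cluster_event h : trivIset setT (cluster_event ^~ h).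
Proof.
move=> i j _ _ [w [[vi ei] [vj ej]]]; apply: nth_fset_inj => //.
by rewrite -ei ej.
Qed.

Lemma finite_clusterE h : [set w | finite_set (clus h w)] = \bigcup_i cluster_event i h.
Proof.
apply/seteqP; split => w /=.
  move=> /finite_fsetP[S CS]; have [i vi iS] := nth_fset_surj S.
  by exists i => //; split => //; rewrite iS.
by move=> [i _ [_ ->]]; exact: finite_fset.
Qed.

Lemma ANE N h : AN nb phi [set` X] N h =
  \bigcup_(i in [set i | N%:R - 1 <= cap (R := R) nb (closure_nb nb [set` nth_fset i]) < N%:R])
    cluster_event i h.
Proof.
apply/seteqP; split => w.
  move=> [fw cN]; have : [set w | finite_set (clus h w)] w by [].
  rewrite finite_clusterE => -[i _ [vi ei]]; exists i => //.
  by rewrite /= -ei.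
move=> [i /= cN [vi ei]]; rewrite /AN /= ei; split => //; exact: finite_fset.
Qed.

Lemma measurable_AN N h : measurable (AN nb phi [set` X] N h).
Proof.
by rewrite ANE; apply: bigcup_measurable => i _; exact: measurable_cluster_event.
Qed.

Lemma event_capacity_le i : event_capacity i <=
  cap nb (closure_nb nb [set` nth_fset i]) + cap nb [set` X].
Proof.
rewrite /event_capacity witness_setE; apply: (cap_setU tr); last exact: finite_fset.
rewrite /closure_nb finite_setU; split; first exact: finite_fset.
apply: (@sub_finite_set _ _ [set` witness (nth_fset i)]); last exact: finite_seq.
by move=> x /= [y [yS xy]]; rewrite mem_witness; apply/or3P; constructor 3; apply/hasP; exists y.
Qed.

End cluster_events.

(** * Termwise differentiation *)

Lemma is_derive_of_quadratic_remainder (R : realType) (f : R -> R) (x l C rho : R) :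
  0 < rho -> (forall y, `|y - x| <= rho -> `|f y - f x - (y - x) * l| <= C * (y - x) ^+ 2) ->
  is_derive x 1 f l.
Proof.
move=> rho0 rem.
have lim : h^-1 *: (f (h *: 1 + x) - f x) @[h --> 0^'] --> l.
  apply/cvgrPdist_le => e e0.
  have C1 : 0 < `|C| + 1 by rewrite ltr_wpDl.
  pose dl := Num.min rho (e / (`|C| + 1)).
  have dl0 : 0 < dl by rewrite lt_min rho0 divr_gt0.
  near=> h.
  have h0 : h != 0 by near: h; exact: nbhs_dnbhs_neq.
  have hdl : `|h| <= dl.
    near: h; apply: dnbhs0_le; exact: dl0.
  have hx : h *: 1 + x - x = h by rewrite addrK /GRing.scale /= mulr1.
  have := rem (h *: 1 + x); rewrite hx => /(_ (le_trans hdl _)).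
  rewrite ge_min lexx /= => /(_ isT) H.
  have -> : l - h^-1 *: (f (h *: 1 + x) - f x) =
      - (h^-1 * (f (h *: 1 + x) - f x - h * l)).
    by rewrite /GRing.scale /=; field.
  rewrite normrN normrM normfV ler_pdivrMl ?normr_gt0//.
  apply: (le_trans H); rewrite -real_normK ?num_real// expr2 mulrCA.
  apply: ler_wpM2l => //.
  have : `|h| <= e / (`|C| + 1) by rewrite (le_trans hdl)// ge_min lexx orbT.
  rewrite ler_pdivlMr// => H2.
  have : C * `|h| <= `|C| * `|h| by rewrite ler_wpM2r// ler_norm.
  by have := normr_ge0 h; nra.
apply: DeriveDef; first by apply/cvg_ex; exists l.
exact: cvg_lim.
Unshelve. all: by end_near. Qed.

(** A form without any order between [x] and [y]. The bound on [|z - x|] is kept so that a second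
    application, to the derivative between [x] and [z], again gains a factor [|y - x|]. *)
Lemma mean_value_ball (R : realType) (f g : R -> R) (x0 rho x y : R) :
  (forall t, `|t - x0| <= rho -> is_derive t 1 f (g t)) ->
  `|x - x0| <= rho -> `|y - x0| <= rho ->
  exists z, [/\ `|z - x0| <= rho, `|z - x| <= `|y - x| & f y - f x = g z * (y - x)].
Proof.
move=> fg hx hy.
have main a b : a < b -> `|a - x0| <= rho -> `|b - x0| <= rho ->
    exists z, [/\ a < z < b, `|z - x0| <= rho & f b - f a = g z * (b - a)].
  move=> ab; rewrite !ler_norml => /andP[a1 a2] /andP[b1 b2].
  have ball t : a <= t <= b -> `|t - x0| <= rho.
    by move=> /andP[t1 t2]; rewrite ler_norml; apply/andP; split; lra.
  have [||z] := @MVT _ f g a b ab.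
  - by move=> t; rewrite in_itv /= => /andP[t1 t2]; apply/fg/ball; rewrite !ltW.
  - apply: derivable_within_continuous => t; rewrite in_itv /= => tab.
    by have [] := fg t (ball t tab).
  rewrite in_itv /= => zab e; exists z; split => //.
  by apply: ball; move: zab => /andP[z1 z2]; rewrite !ltW.
have [xy|yx|<-] := ltgtP x y.
- have [z [/andP[z1 z2] zb e]] := main _ _ xy hx hy; exists z; split => //.
  by rewrite !gtr0_norm ?subr_gt0// lerD2r ltW.
- have [z [/andP[z1 z2] zb e]] := main _ _ yx hy hx; exists z; split => //.
    by rewrite !ltr0_norm ?subr_lt0// lerN2 lerD2r ltW.
  by rewrite -opprB e; ring.
- by exists x; split => //; rewrite !subrr mulr0.
Qed.

(** Two applications of the mean value theorem bound the first-order Taylor remainder of the [n]-th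
    term by [B n * (y - x) ^+ 2]. Summed over [n], this is a quadratic remainder for [Phi], so
    summable bounds on second derivatives take the place of uniform convergence. *)
Lemma termwise_derive (R : realType) (Phi : R -> R) (f g g' : nat -> R -> R) (B : nat -> R)
    (x rho K L : R) : 0 < rho ->
  (forall n t, `|t - x| <= rho -> is_derive t 1 (f n) (g n t)) ->
  (forall n t, `|t - x| <= rho -> is_derive t 1 (g n) (g' n t)) ->
  (forall n t, `|t - x| <= rho -> `|g' n t| <= B n) ->
  (forall n, series B n <= K) ->
  (forall t, `|t - x| <= rho -> series (f ^~ t) @ \oo --> Phi t) ->
  series (g ^~ x) @ \oo --> L ->
  is_derive x 1 Phi L.
Proof.
move=> rho0 df dg gB BK fPhi gL.
have xx : `|x - x| <= rho by rewrite subrr normr0 ltW.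
apply: (@is_derive_of_quadratic_remainder _ _ _ _ K rho) => // y hy.
pose r n := f n y - f n x - (y - x) * g n x.
have rB n : `|r n| <= B n * (y - x) ^+ 2.
  have [z [zb zx e]] := mean_value_ball (df n) xx hy.
  have [w [wb _ e']] := mean_value_ball (dg n) xx zb.
  rewrite /r e (mulrC (y - x)) -mulrBl e' !normrM -mulrA.
  apply: ler_pM => //; first exact: gB.
  by rewrite -real_normK ?num_real// expr2; apply: ler_wpM2r.
have sr : series r @ \oo --> Phi y - Phi x - (y - x) * L.
  have -> : series r = (fun n => series (f ^~ y) n - series (f ^~ x) n -
      (y - x) * series (g ^~ x) n).
    by apply/funext => n; rewrite !seriesEnat /= mulr_sumr -!sumrB.
  apply: cvgB; first by apply: cvgB; apply: fPhi.
  by apply: cvgM => //; exact: cvg_cst.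
have nr : (fun n => `|series r n|) @ \oo --> `|Phi y - Phi x - (y - x) * L| by exact: cvg_norm.
have <- : limn (fun n => `|series r n|) = `|Phi y - Phi x - (y - x) * L| by exact: cvg_lim.
apply: limr_le; first by apply/cvg_ex; eexists; exact: nr.
apply: nearW => n.
apply: (@le_trans _ _ (series B n * (y - x) ^+ 2)); last by rewrite ler_wpM2r ?sqr_ge0.
rewrite !seriesEnat /= mulr_suml; apply: (le_trans (ler_norm_sum _ _ _)).
by apply: ler_sum.
Qed.

Lemma abs_series_cvg (R : realType) (u B : nat -> R) (K : R) :
  (forall n, `|u n| <= B n) -> (forall n, series B n <= K) -> cvgn (series u).
Proof.
move=> uB BK; apply: normed_cvg.
apply: (@series_le_cvg _ _ B) => //.
- by move=> n; exact: normr_ge0.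
- by move=> n; exact: le_trans (normr_ge0 _) (uB n).
- apply: nondecreasing_is_cvgn; last by exists K => _ [n _ <-].
  by apply: nondecreasing_series => n _ _; rewrite (le_trans _ (uB n)).
Qed.

(** Once [ln N%:R] is positive, a ratio of logarithms at most [- q] means that [c N] is at most the
    inverse [q]-th power of [N]. *)
Lemma superpoly_bound (R : realType) (c : nat -> R) (q : nat) : superpoly c ->
  exists2 K : R, 0 <= K & forall N, (0 < N)%N -> c N * N%:R ^+ q <= K.
Proof.
move=> [c0 cM]; have [N0 _ N0P] := cM q%:R.
have s0 n : 0 <= c n * n%:R ^+ q by rewrite mulr_ge0// exprn_ge0.
(* Beyond [N0.+2] the number [N] is at least 2 and its logarithm is positive; the sum covers the
   finitely many smaller ones. *)
exists (1 + \sum_(n < N0.+2) c n * n%:R ^+ q); first by rewrite addr_ge0// sumr_ge0.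
move=> N N1; have [NN|NN] := ltnP N N0.+2.
  apply: (@le_trans _ _ (\sum_(n < N0.+2) c n * n%:R ^+ q)); last by rewrite lerDr.
  by rewrite (bigD1 (Ordinal NN))//= lerDl sumr_ge0.
apply: (@le_trans _ _ 1); last by rewrite lerDl sumr_ge0.
have NN0 : (N0 <= N)%N by rewrite (leq_trans _ NN)// -addn2 leq_addr.
have [->|] := N0P N NN0; first by rewrite mul0r.
have [->|cn0] := eqVneq (c N) 0; first by rewrite mul0r.
have cp : 0 < c N by rewrite lt_neqAle eq_sym cn0 c0.
have Np : 0 < N%:R :> R by rewrite ltr0n.
have lN : 0 < ln (N%:R : R) by rewrite ln_gt0// ltr1n (leq_trans _ NN).
rewrite ler_pdivrMr// => h.
have eN : N%:R ^+ q = expR (q%:R * ln (N%:R : R)) by rewrite expRM_natl lnK.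
rewrite -ler_pdivlMr ?exprn_gt0// mul1r eN -expRN -[leLHS](lnK cp) ler_expR.
by rewrite -mulNr.
Qed.

(** Telescoping: adding the term [m.+1%:R^-1] makes the partial sums nonincreasing. The term at 0
    vanishes because the inverse of 0 is 0. *)
Lemma sum_inv_sqr_le (R : realType) n : \sum_(N < n) (N%:R ^+ 2)^-1 <= 2 :> R.
Proof.
have step m : \sum_(N < m.+2) (N%:R ^+ 2)^-1 + m.+1%:R^-1 <= 2 :> R.
  elim: m => [|m IH].
    by rewrite !big_ord_recr big_ord0 /= expr0n expr1n invr0 invr1; lra.
  rewrite big_ord_recr /=; apply: le_trans IH; rewrite -addrA lerD2l.
  have m1 : 0 < m.+1%:R :> R by rewrite ltr0n.
  have e : m.+2%:R = m.+1%:R + 1 :> R by rewrite -natr1.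
  rewrite e; set x : R := m.+1%:R in m1 *.
  have -> : ((x + 1) ^+ 2)^-1 + (x + 1)^-1 = (x + 2) / (x + 1) ^+ 2.
    by field; rewrite gt_eqF// addr_gt0.
  rewrite ler_pdivrMr ?exprn_gt0 ?addr_gt0// ler_pdivlMl//.
  by rewrite -subr_ge0; have -> : (x + 1) ^+ 2 - x * (x + 2) = 1 by ring.
case: n => [|[|m]]; first by rewrite big_ord0.
  by rewrite big_ord_recl big_ord0 /= expr0n invr0 addr0.
by apply: le_trans (step m); rewrite lerDl invr_ge0.
Qed.

(** * Summation over finite clusters *)

Section summation.
Variables (R : realType) (V : countType) (nb : V -> seq V).
Hypothesis sg : simple_graph nb.
Hypothesis gc : graph_connected nb.
Hypothesis tr : transient (R := R) nb.
Context d (Omega : measurableType d) (P : probability Omega R).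
Variable phi : V -> Omega -> R.
Hypothesis gff : is_GFF nb P phi.
Variable X : {fset V}.
Variable F : set V -> R.
Local Notation cap := (cap (R := R) nb).
Local Notation fset_at := (nth_fset V).

Definition cluster_prob (i : nat) (t : R) : R :=
  glap P (event_weight nb phi X i) (event_field nb phi X i) (event_capacity R nb X i) 0 t.

Definition cluster_prob_deriv (k i : nat) (t : R) : R :=
  glap_deriv P (event_weight nb phi X i) (event_field nb phi X i) (event_capacity R nb X i) k 0 t.

Definition observable_at (i : nat) : R := F [set` fset_at i].

Definition closure_cap (i : nat) : R := cap (closure_nb nb [set` fset_at i]).

(** The [N] for which the closure of the set satisfies the capacity condition in [AN]; it is at
    least 1, the range in which tail bounds are assumed. *)
Definition cap_level (i : nat) : nat := (Num.truncn (closure_cap i)).+1.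

Definition cap_offset : nat := (Num.truncn (cap [set` X])).+1.

Lemma cap_level_itv i : (cap_level i)%:R - 1 <= closure_cap i < (cap_level i)%:R.
Proof.
have := truncn_itv (cap_ge0 tr (closure_nb nb [set` fset_at i])).
by rewrite /cap_level -/(closure_cap i) -[X in _ -> (X - _ <= _ < _)]natr1 addrK.
Qed.

Lemma cluster_prob_ge0 i (t : R) : 0 <= cluster_prob i t.
Proof. by apply: glap_ge0 => w; exact: event_weight_ge0. Qed.

Lemma is_derive_cluster_prob_deriv k i (t : R) :
  is_derive t 1 (cluster_prob_deriv k i) (cluster_prob_deriv k.+1 i t).
Proof.
apply: is_derive_glap_deriv.
- by move=> w; exact: event_weight_ge0.
- exact: (measurable_event_weight gff).
- exact: (measurable_event_field gff).
- exact: (event_capacity_ge0 tr).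
- exact: (integrable_event_weight gff).
Qed.

Lemma cluster_event_probE i (t : R) : P (cluster_event nb phi X i t) = (cluster_prob i t)%:E.
Proof. exact: cluster_event_prob. Qed.

Lemma event_capacity_level i : event_capacity R nb X i <= (cap_level i + cap_offset)%:R :> R.
Proof.
apply: (le_trans (event_capacity_le tr X i)); rewrite natrD; apply: lerD.
  by have /andP[_ /ltW] := cap_level_itv i.
have /andP[_ /ltW] := truncn_itv (cap_ge0 tr [set` X]); exact.
Qed.

(** The cluster events of one level are disjoint subsets of [AN], so their probabilities add up to
    at most that of [AN], however many sets have this level. *)
Lemma level_prob_le (N I : nat) t (c : R) : (P (AN nb phi [set` X] N t) <= c%:E)%E ->
  \sum_(i < I) (cap_level i == N)%:R * cluster_prob i t <= c.
Proof.
move=> PN.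
pose E i := if cap_level i == N then cluster_event nb phi X i t else set0.
have mE i : measurable (E i).
  by rewrite /E; case: ifP => // _; exact: (measurable_cluster_event gff).
have Eevent i w : E i w -> cluster_event nb phi X i t w by rewrite /E; case: ifP.
have tE : trivIset setT E.
  move=> i j _ _ [w [/Eevent wi /Eevent wj]].
  by apply: (@trivIset_cluster_event R V nb _ Omega phi X t) => //; exists w.
rewrite -lee_fin -sumEFin.
have -> : (\sum_(i < I) ((cap_level i == N)%:R * cluster_prob i t)%:E =
    P (\big[setU/set0]_(i < I) E i))%E.
  rewrite measure_bigsetU//; apply: eq_bigr => i _.
  rewrite /E; case: ifP => _; last by rewrite mul0r measure0.
  by rewrite mul1r; apply/esym; exact: cluster_event_probE.
apply: le_trans PN; apply: le_measure; rewrite ?inE.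
- exact: bigsetU_measurable.
- exact: (measurable_AN gff).
rewrite ANE -bigcup_mkord => w [i _]; rewrite /E; case: ifP => // /eqP iN wi.
by exists i => //=; rewrite -iN; exact: cap_level_itv.
Qed.

(** * Derivative bounds uniform over a neighbourhood of heights *)

Section local_bound.
Variables (h0 rho : R).
Hypothesis rho01 : 0 < rho <= 1.

Definition grid_step (n : nat) : R := rho / n%:R.

Definition grid_point (n j : nat) : R := h0 - rho + j%:R * grid_step n.

Lemma mul_grid_step n : (0 < n)%N -> n%:R * grid_step n = rho.
Proof. by move=> n0; rewrite /grid_step mulrC divfK// gt_eqF// ltr0n. Qed.

Lemma grid_near n t : (0 < n)%N -> `|t - h0| <= rho ->
  exists2 j : nat, (j < (2 * n).+1)%N & `|t - grid_point n j| <= grid_step n.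
Proof.
move=> n0; rewrite ler_norml => /andP[t1 t2].
have /andP[r0 r1] := rho01.
have nR : 0 < n%:R :> R by rewrite ltr0n.
have s0 : 0 < grid_step n by rewrite divr_gt0.
have q0 : 0 <= (t - (h0 - rho)) / grid_step n by apply: divr_ge0; [lra|exact: ltW].
have /andP[j1 j2] := truncn_itv q0.
set j := Num.truncn _ in j1 j2; exists j.
  rewrite ltnS -(ler_nat R) (le_trans j1)// ler_pdivrMr// natrM.
  by rewrite -mulrA mul_grid_step//; lra.
move: j1 j2; rewrite ler_pdivlMr// ltr_pdivrMr// -natr1 mulrDl mul1r => j1 j2.
by rewrite /grid_point ler_norml; apply/andP; split; lra.
Qed.

(** Grid points are within [rho] of [h0] and the mesh is at most [rho]; hence the radius [3 * rho]
    on which tail bounds are required. *)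
Lemma grid_shift n j e : (0 < n)%N -> (j < (2 * n).+1)%N -> `|e| = 2 * grid_step n ->
  `|grid_point n j + e - h0| <= 3 * rho.
Proof.
move=> n0 jn ee; have /andP[r0 r1] := rho01.
have nR : 1 <= n%:R :> R by rewrite ler1n.
have s1 : grid_step n <= rho by rewrite ler_pdivrMr ?ler_peMr// ?ltW// (lt_le_trans _ nR).
have s0 : 0 <= grid_step n by rewrite divr_ge0// ltW.
have js : j%:R * grid_step n <= 2 * rho.
  apply: (@le_trans _ _ ((2 * n)%:R * grid_step n)).
    by rewrite ler_wpM2r// ler_nat.
  by rewrite natrM -mulrA mul_grid_step.
have js0 : 0 <= j%:R * grid_step n by rewrite mulr_ge0.
move: ee (ler_norm e) (ler_norm (- e)); rewrite normrN => -> e1 e2.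
by rewrite /grid_point ler_norml; apply/andP; split; lra.
Qed.

(** An integer bound on the capacity of the sites deciding the event; it depends on [i] only through
    the level, so all sets of a level share one grid. *)
Definition event_scale (i : nat) : nat := (cap_level i + cap_offset)%N.

(** Summing over all grid points, instead of keeping the nearest one, removes the dependence on the
    height. *)
Definition grid_prob (n i : nat) : R :=
  \sum_(j < (2 * n).+1) (cluster_prob i (grid_point n j + 2 * grid_step n) +
                         cluster_prob i (grid_point n j - 2 * grid_step n)).

(* A bound on the [k]-th derivative uniform over [h0 - rho, h0 + rho], obtained
   by controlling it from the nearest point of a grid of mesh [rho / event_scale i]. *)
Definition deriv_bound (k i : nat) : R :=
  `|observable_at i| * (glap_const k 0 * (grid_step (event_scale i))^-1 ^+ k *
    grid_prob (event_scale i) i).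

Lemma deriv_boundP k i t : `|t - h0| <= rho ->
  `|observable_at i * cluster_prob_deriv k i t| <= deriv_bound k i.
Proof.
move=> th; have /andP[r0 r1] := rho01.
set n := event_scale i; have n0 : (0 < n)%N by [].
have nR : 1 <= n%:R :> R by rewrite ler1n.
have nR0 : 0 < n%:R :> R by rewrite ltr0n.
have s0 : 0 < grid_step n by rewrite divr_gt0.
rewrite normrM /deriv_bound ler_wpM2l// -/n.
have [j jn tj] := grid_near n0 th.
apply: (@le_trans _ _ (glap_const k 0 * (grid_step n)^-1 ^+ (0 + k) *
    (cluster_prob i (grid_point n j + 2 * grid_step n) +
     cluster_prob i (grid_point n j - 2 * grid_step n)))).
  apply: glap_deriv_shift => //.
  - by move=> w; exact: event_weight_ge0.
  - exact: (measurable_event_weight gff).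
  - exact: (measurable_event_field gff).
  - exact: (event_capacity_ge0 tr).
  - exact: (integrable_event_weight gff).
  (* The capacity is at most [n] and [rho] at most 1, so the mesh [rho / n] meets the condition
     [c * r ^+ 2 <= 1] with room to spare. *)
  - rewrite /grid_step exprMn exprVn mulrA ler_pdivrMr ?exprn_gt0// mul1r.
    apply: (@le_trans _ _ (n%:R * 1)); last by rewrite mulr1 expr2 ler_peMr// ltW.
    apply: ler_pM; [exact: (event_capacity_ge0 tr)|exact: sqr_ge0|exact: event_capacity_level|].
    by rewrite exprn_ile1// ltW.
rewrite add0n; apply: ler_wpM2l.
  by rewrite mulr_ge0 ?glap_const_ge0// exprn_ge0// invr_ge0 ltW.
rewrite /grid_prob (bigD1 (Ordinal jn))//= lerDl sumr_ge0// => l _.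
by rewrite addr_ge0// cluster_prob_ge0.
Qed.

Variables (C0 : R) (D : nat) (c : nat -> R).
Hypothesis C00 : 0 <= C0.
Hypothesis growth : forall i, `|observable_at i| <= C0 * (1 + closure_cap i) ^+ D.
Hypothesis c_superpoly : superpoly c.
Hypothesis tail : forall N t, (1 <= N)%N -> `|t - h0| <= 3 * rho ->
  (P (AN nb phi [set` X] N t) <= (c N)%:E)%E.

(** At a fixed level only the probabilities vary with [i]. After exchanging the sums, each of the
    two shifts of each grid point contributes at most [c N]. *)
Lemma level_sum_le k N I : (1 <= N)%N ->
  \sum_(i < I) (cap_level i == N)%:R * deriv_bound k i <=
  C0 * (1 + N%:R) ^+ D * (glap_const k 0 * (grid_step (N + cap_offset))^-1 ^+ k) *
  ((2 * (N + cap_offset)).+1%:R * (2 * c N)).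
Proof.
move=> N1; have /andP[r0 r1] := rho01.
set n := (N + cap_offset)%N; have n0 : (0 < n)%N by rewrite /n addnS.
set T := C0 * _ * _.
have s0 : 0 < grid_step n by rewrite divr_gt0// ltr0n.
have A0 : 0 <= glap_const k 0 * (grid_step n)^-1 ^+ k.
  by rewrite mulr_ge0 ?glap_const_ge0// exprn_ge0// invr_ge0 ltW.
have gp0 m i : 0 <= grid_prob m i.
  by apply: sumr_ge0 => j _; rewrite addr_ge0// cluster_prob_ge0.
apply: (@le_trans _ _ (\sum_(i < I) (cap_level i == N)%:R * (T * grid_prob n i))).
  apply: ler_sum => i _; have [iN|_] := eqVneq (cap_level i) N; last by rewrite !mul0r.
  rewrite !mul1r /deriv_bound /event_scale iN -/n mulrA.
  apply: ler_wpM2r => //; rewrite /T; apply: ler_wpM2r => //.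
  apply: (le_trans (growth i)); apply: ler_wpM2l => //.
  have /andP[_ cN] := cap_level_itv i.
  rewrite lerXn2r ?nnegrE ?addr_ge0//; first exact: (cap_ge0 tr).
  by rewrite lerD2l ltW// -iN.
under eq_bigr do rewrite mulrCA.
rewrite -mulr_sumr; apply: ler_wpM2l.
  by rewrite /T mulr_ge0// mulr_ge0// exprn_ge0// addr_ge0.
under eq_bigr do rewrite /grid_prob mulr_sumr.
rewrite exchange_big /=.
apply: (@le_trans _ _ (\sum_(j < (2 * n).+1) 2 * c N)); last first.
  by rewrite sumr_const card_ord -[leLHS]mulr_natl.
apply: ler_sum => j _; under eq_bigr do rewrite mulrDr.
rewrite big_split /=; have -> : 2 * c N = c N + c N by ring.
apply: lerD; apply: level_prob_le; apply: tail => //.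
  by apply: grid_shift => //; rewrite ger0_norm// mulr_ge0// ltW.
by apply: grid_shift => //; rewrite normrN ger0_norm// mulr_ge0// ltW.
Qed.

Lemma deriv_bound_summable k : exists K : R, forall I, series (deriv_bound k) I <= K.
Proof.
have /andP[r0 r1] := rho01.
(* Exponents: [D] for the growth of the observable, [k] for the derivatives, 1 for the number of
   grid points, and 2 to leave a summable inverse square. *)
have [K K0 Kc] := superpoly_bound (D + k + 1 + 2) c_superpoly.
have c0 N : 0 <= c N by case: c_superpoly.
pose m1 : R := cap_offset.+1%:R.
have m10 : 0 <= m1 by rewrite ler0n.
(* Obtained from [1 + N <= 2 N] for the growth, [N + cap_offset <= N * m1] for the scale, and
   [2 n + 1 <= 3 n] for the grid points, each carrying two shifts. *)
pose K1 := C0 * 2 ^+ D * (glap_const k 0 * (m1 / rho) ^+ k) * (6 * m1).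
have K10 : 0 <= K1.
  rewrite /K1; apply: mulr_ge0; last exact: mulr_ge0.
  by rewrite mulr_ge0 ?mulr_ge0 ?exprn_ge0 ?divr_ge0 ?glap_const_ge0 ?(ltW r0).
have lev N I : \sum_(i < I) (cap_level i == N)%:R * deriv_bound k i <=
    K1 * K * (N%:R ^+ 2)^-1.
  case: N => [|N'].
    rewrite big1 => [|i _]; last by rewrite mul0r.
    by rewrite expr0n invr0 mulr0.
  set N := N'.+1; have N1 : (1 <= N)%N by [].
  have NR : 1 <= N%:R :> R by rewrite ler1n.
  have NR0 : 0 < N%:R :> R by rewrite ltr0n.
  apply: (le_trans (level_sum_le k I N1)).
  have nm : (N + cap_offset)%:R <= N%:R * m1.
    rewrite /m1 -natrM ler_nat mulnS leq_add2l leq_pmull//.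
  apply: (@le_trans _ _ (K1 * (N%:R ^+ (D + k + 1) * c N))).
    have -> : K1 * (N%:R ^+ (D + k + 1) * c N) =
       C0 * (2 * N%:R) ^+ D * (glap_const k 0 * ((N%:R * m1) / rho) ^+ k) *
       (3 * (N%:R * m1) * (2 * c N)).
      rewrite /K1 !exprMn !exprD expr1; ring.
    have g0 : 0 <= grid_step (N + cap_offset) by rewrite divr_ge0// ltW.
    apply: ler_pM.
    - by rewrite mulr_ge0// mulr_ge0 ?exprn_ge0 ?glap_const_ge0 ?addr_ge0 ?invr_ge0.
    - by rewrite !mulr_ge0.
    - apply: ler_pM.
      + by rewrite mulr_ge0// exprn_ge0// addr_ge0.
      + by rewrite mulr_ge0 ?glap_const_ge0// exprn_ge0// invr_ge0.
      + apply: ler_wpM2l => //; rewrite lerXn2r ?nnegrE ?addr_ge0 ?mulr_ge0//.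
        by rewrite mulr_natl mulr2n lerD2r.
      + apply: ler_wpM2l; first exact: glap_const_ge0.
        rewrite lerXn2r ?nnegrE ?invr_ge0// ?divr_ge0 ?mulr_ge0 ?(ltW r0)//.
        by rewrite /grid_step invf_div ler_pM2r ?invr_gt0.
    - apply: ler_wpM2r; first by rewrite mulr_ge0.
      rewrite -natr1 natrM.
      have : 1 <= (N + cap_offset)%:R :> R by rewrite ler1n addnS.
      lra.
  rewrite -mulrA; apply: ler_wpM2l => //.
  rewrite ler_pdivlMr ?exprn_gt0//; apply: le_trans (Kc N N1).
  by rewrite mulrAC -exprD mulrC.
exists (K1 * K * 2) => I; rewrite seriesEnat /= big_mkord.
(* A partial sum meets finitely many levels and can be regrouped by level. *)
pose L := (\max_(i < I) cap_level i).+1.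
have -> : \sum_(i < I) deriv_bound k i =
    \sum_(N < L) \sum_(i < I) (cap_level i == N)%:R * deriv_bound k i.
  rewrite exchange_big /=; apply: eq_bigr => i _.
  have iL : (cap_level i < L)%N by rewrite ltnS; exact: (leq_bigmax i).
  rewrite (bigD1 (Ordinal iL))//= eqxx mul1r big1 ?addr0// => N NL.
  case: eqP => [e|_]; last by rewrite mul0r.
  by move: NL; rewrite -val_eqE /= e eqxx.
apply: (@le_trans _ _ (\sum_(N < L) K1 * K * (N%:R ^+ 2)^-1)).
  by apply: ler_sum => N _; exact: lev.
by rewrite -mulr_sumr; apply: ler_wpM2l; [exact: mulr_ge0|exact: sum_inv_sqr_le].
Qed.

End local_bound.
End summation.

(** * Expectation of an observable as a series over clusters *)

Section observable.
Variables (R : realType) (V : countType) (nb : V -> seq V).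
Hypothesis sg : simple_graph nb.
Hypothesis gc : graph_connected nb.
Hypothesis tr : transient (R := R) nb.
Context d (Omega : measurableType d) (P : probability Omega R).
Variable phi : V -> Omega -> R.
Hypothesis gff : is_GFF nb P phi.
Variable X : {fset V}.
Local Notation event := (cluster_event nb phi X).
Local Notation prob := (cluster_prob nb P phi X).
Local Notation dprob := (cluster_prob_deriv nb P phi X).

(** At most one of the disjoint events occurs at [w], so the partial sums jump at most once, from 0
    to the final value. This makes [|v|] a dominating function for them. *)
Lemma series_event (a : nat -> R) v w t :
  (exists2 i, event i t w & v = a i) \/ ((forall i, ~ event i t w) /\ v = 0) ->
  (forall n, series (fun i => a i * \1_(event i t) w) n = 0 \/
             series (fun i => a i * \1_(event i t) w) n = v) /\
  series (fun i => a i * \1_(event i t) w) @ \oo --> v.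
Proof.
move=> [[i wi ->]|[nw ->]]; last first.
  have s0 n : series (fun i => a i * \1_(event i t) w) n = 0.
    rewrite seriesEnat /= big1// => i _; rewrite indicE memNset ?mulr0//; exact: nw.
  split=> [n|]; first by left.
  by rewrite (funext s0); exact: cvg_cst.
have other j : j != i -> \1_(event j t) w = 0 :> R.
  move=> ji; rewrite indicE memNset// => wj; move/eqP: ji; apply.
  by apply: (@trivIset_cluster_event R V nb _ Omega phi X t) => //; exists w.
have si n : series (fun i => a i * \1_(event i t) w) n = if (i < n)%N then a i else 0.
  rewrite seriesEnat /= big_mkord; case: ifPn => [iN|].
    rewrite (bigD1 (Ordinal iN))//= indicE mem_set//= mulr1 big1 ?addr0// => j ji.
    by rewrite other ?mulr0//; apply: contra ji => /eqP ji; apply/eqP/val_inj.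
  rewrite -leqNgt => ni; rewrite big1// => j _; rewrite other ?mulr0//.
  by rewrite ltn_eqF// (leq_trans (ltn_ord j)).
split=> [n|]; first by rewrite si; case: ifP; [right|left].
apply: cvg_near_cst; near=> n; rewrite si ifT//.
by near: n; exists i.+1.
Unshelve. all: by end_near. Qed.

Lemma obs_rv_cases (F : set V -> R) t w :
  let v := obs_rv nb phi F [set` X] t w in
  (exists2 i, event i t w & v = observable_at F i) \/ ((forall i, ~ event i t w) /\ v = 0).
Proof.
move=> v; rewrite /v /obs_rv indicE.
have fE : finite_set (Defs.cluster nb phi t [set` X] w) <-> exists i, event i t w.
  have := finite_clusterE nb phi X t => /seteqP[f1 f2]; split.
    by move=> /f1[i _ wi]; exists i.
  by move=> [i wi]; apply: f2; exists i.
have [fw|nfw] := pselect (finite_set (Defs.cluster nb phi t [set` X] w)).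
  left; have [i wi] := fE.1 fw; exists i => //.
  by rewrite mem_set// mulr1 wi.2.
right; split; first by move=> i wi; apply: nfw; apply: fE.2; exists i.
by rewrite memNset// mulr0.
Qed.

Lemma integral_event a i t :
  P.-integrable setT (fun w => (a * \1_(event i t) w)%:E) /\
  (\int[P]_w (a * \1_(event i t) w)%:E = (a * prob i t)%:E)%E.
Proof.
have mE := measurable_cluster_event gff X i t.
have iE : P.-integrable setT (fun w => (\1_(event i t) w : R)%:E).
  exact: integrable_indic.
split; first by under eq_fun do rewrite EFinM; exact: integrableZl.
under eq_integral do rewrite EFinM.
rewrite integralZl// integral_indic// setIT EFinM; congr (_ * _)%E.
exact: cluster_event_probE.
Qed.

(** The absolute series first yields integrability of the observable by monotone convergence; its
    absolute value then dominates the partial sums, and limit and expectation may be exchanged. *)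
Lemma Fbar_series (F : set V -> R) t K :
  (forall n, series (fun i => `|observable_at F i| * prob i t) n <= K) ->
  P.-integrable setT (fun w => (obs_rv nb phi F [set` X] t w)%:E) /\
  series (fun i => observable_at F i * prob i t) @ \oo --> Fbar nb P phi F [set` X] t.
Proof.
move=> sK.
pose v := obs_rv nb phi F [set` X] t.
pose g n w := series (fun i => observable_at F i * \1_(event i t) w) n.
have gv w : (forall n, g n w = 0 \/ g n w = v w) /\ g ^~ w @ \oo --> v w.
  by apply: series_event; exact: obs_rv_cases.
have ig n : P.-integrable setT (fun w => (g n w)%:E) /\
    (\int[P]_w (g n w)%:E = (series (fun i => observable_at F i * prob i t) n)%:E)%E.
  have E w : (g n w)%:E = (\sum_(i <- index_iota 0 n) (observable_at F i * \1_(event i t) w)%:E)%E.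
    by rewrite /g seriesEnat /= sumEFin.
  rewrite (funext E); split.
    by apply: integrable_sum => // i _; have [] := integral_event (observable_at F i) i t.
  rewrite integral_sum//; last by move=> i; exact: (integral_event (observable_at F i) i t).1.
  rewrite seriesEnat /= -sumEFin; apply: eq_bigr => i _.
  by have [] := integral_event (observable_at F i) i t.
have mg n : measurable_fun [set: Omega] (fun w => (g n w)%:E).
  by have [/measurable_int] := ig n.
have gvE w : (fun n => (g n w)%:E) @ \oo --> (v w)%:E.
  by apply: cvg_EFin; [exact: nearW|exact: (gv w).2].
have mv : measurable_fun [set: Omega] (fun w => (v w)%:E).
  by apply: (emeasurable_fun_cvg _ _ mg) => w _; exact: gvE.
have iv : P.-integrable setT (fun w => (v w)%:E).
  apply/integrableP; split => //.
  have absE w : (`|(v w)%:E| = \sum_(i <oo) (`|observable_at F i| * \1_(event i t) w)%:E)%E.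
    apply/esym/cvg_lim => //=.
    under eq_fun do rewrite sumEFin.
    apply: cvg_EFin; first exact: nearW.
    apply: (series_event _).2.
    have [[i wi vi]|[nw v0]] := obs_rv_cases F t w; [left|right; split=> //].
      by exists i => //; rewrite /v vi.
    by rewrite /v v0 normr0.
  under eq_integral do rewrite absE.
  have ma n : measurable_fun [set: Omega]
      (fun w => (`|observable_at F n| * \1_(event n t) w)%:E).
    by have [/measurable_int] := integral_event `|observable_at F n| n t.
  rewrite integral_nneseries//.
  apply: (@le_lt_trans _ _ K%:E); last exact: ltry.
  apply: lime_le.
    apply: is_cvg_ereal_nneg_natsum => n _; apply: integral_ge0 => w _.
    by rewrite lee_fin mulr_ge0.
  apply: nearW => n.
  have -> : (\sum_(0 <= i < n) \int[P]_w (`|observable_at F i| * \1_(event i t) w)%:E =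
      (series (fun i => `|observable_at F i| * prob i t) n)%:E)%E.
    rewrite seriesEnat /= -sumEFin; apply: eq_bigr => i _.
    by have [] := integral_event `|observable_at F i| i t.
  by rewrite lee_fin.
split=> //.
have [||||_ _] := @dominated_convergence _ _ _ P _ measurableT (fun n w => (g n w)%:E)
    (fun w => (v w)%:E) (fun w => `|(v w)%:E|%E) mg.
- exact: mv.
- by apply: aeW => w _; exact: gvE.
- exact: integrable_abse.
- apply: aeW => w n _; rewrite lee_fin.
  by have [->|->] := (gv w).1 n; rewrite ?normr0.
move=> cint.
have : (fun n => \int[P]_w (g n w)%:E)%E @ \oo --> (Fbar nb P phi F [set` X] t)%:E.
  by rewrite /Fbar fineK//; exact: integrable_fin_num.
rewrite (funext (fun n => (ig n).2)) => /fine_cvgP[_].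
exact.
Qed.

Variables (F : set V -> R) (C0 : R) (D : nat).
Hypothesis C00 : 0 <= C0.
Hypothesis growth : forall i, `|observable_at F i| <= C0 * (1 + closure_cap R nb i) ^+ D.

(** Order 0 is [Fbar] itself rather than its series: [smooth_on] asks for equality of functions on
    the whole line, whereas the series is only shown to represent [Fbar] near suitable heights. *)
Definition Fbar_deriv (k : nat) (t : R) : R :=
  if k is 0%N then Fbar nb P phi F [set` X] t
  else limn (series (fun i => observable_at F i * dprob k i t)).

Lemma Fbar_local (h0 rho : R) (c : nat -> R) : 0 < rho <= 1 -> superpoly c ->
  (forall N t, (1 <= N)%N -> `|t - h0| <= 3 * rho ->
    (P (AN nb phi [set` X] N t) <= (c N)%:E)%E) ->
  P.-integrable setT (fun w => (obs_rv nb phi F [set` X] h0 w)%:E) /\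
  forall k, is_derive h0 1 (Fbar_deriv k) (Fbar_deriv k.+1 h0).
Proof.
move=> rho01 cs tail; have /andP[r0 r1] := rho01.
have bP k i t := @deriv_boundP R V nb tr _ Omega P phi gff X F h0 rho rho01 k i t.
have bS k := @deriv_bound_summable R V nb sg gc tr _ Omega P phi gff X F h0 rho rho01
  C0 D c C00 growth cs tail k.
have h00 : `|h0 - h0| <= rho by rewrite subrr normr0 ltW.
have cv k t : `|t - h0| <= rho -> cvgn (series (fun i => observable_at F i * dprob k i t)).
  move=> th; have [K SK] := bS k.
  by apply: (abs_series_cvg (B := deriv_bound nb P phi X F h0 rho k)) SK => n; exact: bP.
have fb t : `|t - h0| <= rho ->
    P.-integrable setT (fun w => (obs_rv nb phi F [set` X] t w)%:E) /\
    series (fun i => observable_at F i * prob i t) @ \oo --> Fbar nb P phi F [set` X] t.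
  move=> th; have [K SK] := bS 0%N; apply: (@Fbar_series _ _ K) => n.
  apply: le_trans (SK n); rewrite !seriesEnat /=; apply: ler_sum => i _.
  have p0 : 0 <= dprob 0 i t by exact: cluster_prob_ge0.
  by have := bP 0%N i t th; rewrite normrM (ger0_norm p0).
split=> [|k]; first exact: (fb _ h00).1.
(* Differentiating the series of order [k] needs summable bounds on the second derivatives of its
   terms, that is, order [k.+2]. *)
have [K SK] := bS k.+2.
have dk j i (t : R) : is_derive t 1 (fun t => observable_at F i * dprob j i t)
    (observable_at F i * dprob j.+1 i t).
  have h := is_derive_cluster_prob_deriv tr gff X j i t.
  exact: is_deriveZ.
apply: (@termwise_derive R _ (fun i t => observable_at F i * dprob k i t)
  (fun i t => observable_at F i * dprob k.+1 i t)
  (fun i t => observable_at F i * dprob k.+2 i t)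
  (deriv_bound nb P phi X F h0 rho k.+2) h0 rho K) => //.
- by move=> i t; exact: bP.
- move=> t th; case: k {SK} => [|k]; first exact: (fb t th).2.
  exact: cv.
- exact: cv.
Qed.

End observable.

(** * Smoothness outside the interval between the two thresholds *)

(** The base [1 + cap] is at least 1, so the exponent may be rounded up to an integer; the absolute
    value covers a negative [C]. *)
Lemma poly_growth_nat (R : realType) (V : countType) (nb : V -> seq V) (F : set V -> R)
    (C : R) : transient (R := R) nb ->
  (forall S : set V, finite_set S ->
    `|F S| <= C * (1 + cap (R := R) nb (closure_nb nb S)) `^ C) ->
  exists C0 D, 0 <= C0 /\
    forall i, `|observable_at F i| <= C0 * (1 + closure_cap R nb i) ^+ D.
Proof.
move=> tr FC; exists `|C|, (Num.truncn `|C|).+1; split => // i.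
apply: (le_trans (FC _ (finite_fset _))); rewrite -/(closure_cap R nb i).
have c1 : 1 <= 1 + closure_cap R nb i by rewrite lerDl (cap_ge0 tr).
apply: (@le_trans _ _ (`|C| * (1 + closure_cap R nb i) `^ C)).
  by apply: ler_wpM2r; [exact: powR_ge0|exact: ler_norm].
apply: ler_wpM2l => //; rewrite -powR_mulrn ?(le_trans _ c1)//.
apply: ler_powR => //; apply: (le_trans (ler_norm _)).
by have /andP[_ /ltW] := truncn_itv (normr_ge0 C).
Qed.

(** A height beyond a threshold is separated from it by an admissible [h1]. The tail bound at [h1]
    holds on the half-line containing [h0], hence on the ball around [h0] of radius [|h1 - h0|]. *)
Lemma tail_window (R : realType) (V : countType) (nb : V -> seq V) d
    (Omega : measurableType d) (P : probability Omega R) (phi : V -> Omega -> R) (o : V)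
    (X : set V) (h0 : R) : finite_set X ->
  (h0%:E < htilde nb P phi o)%E \/ (hhat nb P phi o < h0%:E)%E ->
  exists (rho : R) (c : nat -> R), [/\ 0 < rho <= 1, superpoly c &
    forall N t, (1 <= N)%N -> `|t - h0| <= 3 * rho -> (P (AN nb phi X N t) <= (c N)%:E)%E].
Proof.
move=> fX hU.
suff [h1 h10 [H [tb near]]] : exists2 h1 : R, h1 != h0 & exists H : R -> Prop,
    tail_bound nb P phi H /\ forall t : R, `|t - h0| <= `|h1 - h0| -> H t.
  have [c [cs cP]] := tb X fX; have h10' : 0 < `|h1 - h0| by rewrite normr_gt0 subr_eq0.
  (* The division by 3 makes the window of radius [3 * rho] fit in this ball; the cap at 1 serves
     the condition on the grid mesh. *)
  exists (Num.min 1 (`|h1 - h0| / 3)), c; split => //.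
    by rewrite lt_min ltr01 ge_min lexx /= divr_gt0.
  move=> N t N1 tr; apply: cP => //; apply: near; apply: (le_trans tr).
  by rewrite mulrC -ler_pdivlMr// ge_min lexx orbT.
case: hU => [/ereal_sup_gt[_ [h1 [_ tb] <-]]|/ereal_inf_lt[_ [h1 [_ tb] <-]]];
    rewrite lte_fin => hh; exists h1.
- by rewrite gt_eqF.
- exists (fun h' => h' <= h1); split=> // t.
  have -> : `|h1 - h0| = h1 - h0 by rewrite gtr0_norm ?subr_gt0.
  by move=> /(le_trans (ler_norm _)); rewrite lerD2r.
- by rewrite lt_eqF.
- exists (fun h' => h1 <= h'); split=> // t.
  have -> : `|h1 - h0| = h0 - h1 by rewrite ltr0_norm ?subr_lt0// opprB.
  by move=> tr; have := le_trans (ler_norm (- (t - h0))); rewrite normrN => /(_ _ tr); lra.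
Qed.

Lemma observable_smooth (R : realType) (V : countType) (nb : V -> seq V) (o : V)
    d (Omega : measurableType d) (P : probability Omega R) (phi : V -> Omega -> R)
    (F : set V -> R) (C : R) (X : set V) :
  simple_graph nb -> graph_connected nb -> transient (R := R) nb -> is_GFF nb P phi ->
  (forall S : set V, finite_set S ->
    `|F S| <= C * (1 + cap (R := R) nb (closure_nb nb S)) `^ C) ->
  finite_set X ->
  let U := [set h : R | (h%:E < htilde nb P phi o)%E \/ (hhat nb P phi o < h%:E)%E] in
  (forall h : R, U h -> P.-integrable setT (fun w => (obs_rv nb phi F X h w)%:E)) /\
  smooth_on U (Fbar nb P phi F X).
Proof.
move=> sg gc tr gff FC fX U.
have [X' XE] := finite_fsetP.1 fX; subst X.
have [C0 [D [C00 growth]]] := poly_growth_nat tr FC.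
have loc h : U h -> P.-integrable setT (fun w => (obs_rv nb phi F [set` X'] h w)%:E) /\
    forall k, is_derive h 1 (Fbar_deriv nb P phi X' F k) (Fbar_deriv nb P phi X' F k.+1 h).
  move=> Uh; have [rho [c [rho01 cs tail]]] := tail_window fX Uh.
  exact: (Fbar_local sg gc tr gff C00 growth rho01 cs tail).
split=> [h /loc[]//|]; exists (Fbar_deriv nb P phi X' F); split=> // k h /loc[_]; exact.
Qed.

Theorem theorem1p6 (R : realType) (V : countType) (nb : V -> seq V) (o : V)
    (d : measure_display) (Omega : measurableType d) (P : probability Omega R)
    (phi : V -> Omega -> R) :
  simple_graph nb -> graph_connected nb -> transient (R := R) nb -> is_GFF nb P phi ->
  forall (Fre Fim : set V -> R), poly_growth nb Fre Fim ->
  forall X : set V, finite_set X ->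
  let U := [set h : R | (h%:E < htilde nb P phi o)%E \/ (hhat nb P phi o < h%:E)%E] in
  (forall h : R, U h ->
     P.-integrable setT (fun w => (obs_rv nb phi Fre X h w)%:E) /\
     P.-integrable setT (fun w => (obs_rv nb phi Fim X h w)%:E)) /\
  smooth_on U (Fbar nb P phi Fre X) /\ smooth_on U (Fbar nb P phi Fim X).
Proof.
move=> sg gc tr gff Fre Fim [C FC] X fX U.
(* The real and imaginary parts are each dominated by the modulus, so both inherit the growth bound
   with the same [C]. *)
have [ire sre] : (forall h : R, U h ->
    P.-integrable setT (fun w => (obs_rv nb phi Fre X h w)%:E)) /\
    smooth_on U (Fbar nb P phi Fre X).
  apply: (@observable_smooth R V nb o _ Omega P phi Fre C X sg gc tr gff _ fX) => S fS.
  apply: le_trans (FC S fS); rewrite -sqrtr_sqr ler_sqrt ?addr_ge0 ?sqr_ge0//.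
  by rewrite lerDl sqr_ge0.
have [iim sim] : (forall h : R, U h ->
    P.-integrable setT (fun w => (obs_rv nb phi Fim X h w)%:E)) /\
    smooth_on U (Fbar nb P phi Fim X).
  apply: (@observable_smooth R V nb o _ Omega P phi Fim C X sg gc tr gff _ fX) => S fS.
  apply: le_trans (FC S fS); rewrite -sqrtr_sqr ler_sqrt ?addr_ge0 ?sqr_ge0//.
  by rewrite lerDr sqr_ge0.
by split=> [h Uh|]; split => //; [exact: ire|exact: iim].
Qed.
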